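(* Let $F(z)=\sum_{k=0}^\infty b_k z^k\in\mathcal{B}$ with $b_1=a\in(0,1)$, where $a=\frac{3\sqrt3}{2}x(1-x^2)$ with $x\in(0,1/\sqrt3)$. Let $r$ satisfy \[ 0<r\le \frac{\sqrt{1/3}-x}{1-x\sqrt{1/3}}. \] Then \[ \sum_{k=1}^\infty k^2|b_k|^2 r^{2k}\le \frac{27 r^2(1-x^2)^2\big((r^2+x^2)(1-r^2x^2)^2-6r^2x^2(1-x^2)(1-r^2)\big)}{4(1-r^2x^2)^5} \] and \[ \sum_{k=1}^\infty k|b_k|^2 r^{2k}\le \frac{27 r^2(1-x^2)^2\big(3x^2(1-r^2)^2+(1-x^2r^2)(r^2-x^2)\big)}{8(1-r^2x^2)^4}. \]
   Context: $\mathbb{D}$ denotes the open unit disc. $\mathcal{B}$ is the class of functions $F$ analytic in $\mathbb{D}$ satisfying $|F'(z)|\le \frac{1}{1-|z|^2}$ for all $z\in\mathbb{D}$. For $F\in\mathcal{B}$ we write its Taylor expansion as $F(z)=\sum_{k=0}^\infty b_k z^k$. *)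

(* Defs.v *)
From Stdlib Require Import Reals.
Open Scope R_scope.

Definition Cpx : Type := (R * R)%type.
Definition Cadd (z w : Cpx) : Cpx := (fst z + fst w, snd z + snd w).
Definition Cmul (z w : Cpx) : Cpx :=
  (fst z * fst w - snd z * snd w, fst z * snd w + snd z * fst w).
Definition Cscal (t : R) (z : Cpx) : Cpx := (t * fst z, t * snd z).
Fixpoint Cpow (z : Cpx) (n : nat) : Cpx :=
  match n with O => (1, 0) | S m => Cmul z (Cpow z m) end.
Definition Cnorm (z : Cpx) : R := sqrt (fst z * fst z + snd z * snd z).

Definition Cseq_cv (u : nat -> Cpx) (l : Cpx) : Prop :=
  Un_cv (fun n => fst (u n)) (fst l) /\ Un_cv (fun n => snd (u n)) (snd l).

Fixpoint Csum (f : nat -> Cpx) (n : nat) : Cpx :=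
  match n with O => f O | S m => Cadd (Csum f m) (f (S m)) end.

Definition in_disc (z : Cpx) : Prop := Cnorm z < 1.

Definition F_terms (b : nat -> Cpx) (z : Cpx) : nat -> Cpx :=
  fun k => Cmul (b k) (Cpow z k).
Definition dF_terms (b : nat -> Cpx) (z : Cpx) : nat -> Cpx :=
  fun k => Cscal (INR (S k)) (Cmul (b (S k)) (Cpow z k)).

(* Class B, described through the Taylor coefficients b of F:
   F(z) = sum b_k z^k is analytic in the unit disc (the series converges for
   every |z|<1) and |F'(z)| <= 1/(1-|z|^2) for all z in the disc. *)
Definition in_class_B (b : nat -> Cpx) : Prop :=
  forall z : Cpx, in_disc z ->
    (exists Fz, Cseq_cv (Csum (F_terms b z)) Fz) /\
    (exists dFz, Cseq_cv (Csum (dF_terms b z)) dFz /\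
                 Cnorm dFz <= 1 / (1 - Cnorm z ^ 2)).

(* Main.v *)
Require Import Defs.
From Stdlib Require Import Reals Lra Lia ClassicalEpsilon.
From Coquelicot Require Import Coquelicot.
Open Scope R_scope.

(** Let [G z = K (z + x) / (1 + x z)^3], [K = (3 sqrt 3 / 2) (1 - x^2)], be the
    derivative of the extremal function.  In the coordinate
    [w = sqrt 3 (z + x) / (1 + x z)] the suitably normalised [F'] maps the unit
    disc to itself and fixes [sqrt 3 x], so the Schwarz-Pick lemma confines
    [F' z] to a disc whose boundary passes through [G z].  Applied to all
    rotations of [F], it confines [F' z] to the intersection of the discs
    attached to the points of modulus [|z|].  Minimising [|G w - F' z|] over
    [|w| <= |z|] then gives [F' z = G (omega z)] with [|omega z| <= |z|]: at a
    boundary minimum [F' z] would lie on the outer normal of the curve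
    [G (|w| = |z|)], which is also the outer normal of the disc attached to [w].
    For [r] in the given range [G] is univalent on [|w| <= r], so [omega] is
    holomorphic.  As in Littlewood's subordination principle, [|G|^2] is at most
    the harmonic function with the same values on [|w| = r], whence the mean of
    [|F'|^2] over [|z| = r] is at most that of [|G|^2].  This is the first
    inequality; integrating it in [r] gives the second. *)

(** * Holomorphic functions with a uniform quadratic remainder *)

(** The constant sqrt 3 is dictated by the growth bound: in the coordinate [w] the estimate |F' z|
    <= 1/(1 - |z|^2) reads 2/(3 - |w|^2) for the normalised derivative, at most 1 when |w| <= 1. The
    upper bound on [r] says that |z| <= r is mapped into |w| <= 1.

    The obstacle is that omega comes from a separate minimisation at each z, so nothing relates its
    values at different points. Regularity is recovered in the variable y = 1 / (1 + x omega). There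
    G is a constant times y^2 - q y^3 with q = 1 - x^2, and its divided difference is bounded away
    from 0. This one bound gives both univalence and the holomorphy of any choice of preimages. On
    the boundary of the disc filled by y, |G|^2 is the real part of a cubic polynomial in y, so the
    harmonic majorant is explicit and its mean is its value at y = 1.

    To do without Cauchy theory, holomorphy is a first-order expansion with uniform quadratic error
    on an arbitrary set. The mean value property and the maximum principle then need only elementary
    estimates and hold up to the boundary circle. *)

Definition hol (D : C -> Prop) (f df : C -> C) : Prop :=
  exists M : R, forall z, D z ->
    Cmod (f z) <= M /\ Cmod (df z) <= M /\
    forall z', D z' ->
      Cmod (f z' - f z - df z * (z' - z)) <= M * Cmod (z' - z) ^ 2.

Lemma Cmod_minus_sym (z w : C) : Cmod (z - w) = Cmod (w - z).
Proof. rewrite <- Cmod_opp; f_equal; ring. Qed.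

Lemma Cmod_sq (z : C) : Cmod z ^ 2 = fst z ^ 2 + snd z ^ 2.
Proof. exact (Cmod2_alt z). Qed.

Lemma Cmod_le_of_sq (z : C) (m : R) :
  0 <= m -> fst z ^ 2 + snd z ^ 2 <= m ^ 2 -> Cmod z <= m.
Proof.
  intros Hm H; apply Rsqr_incr_0_var; [| exact Hm].
  rewrite !Rsqr_pow2, Cmod_sq; exact H.
Qed.

Lemma Cmod_le_sq (z w : C) : Cmod z ^ 2 <= Cmod w ^ 2 -> Cmod z <= Cmod w.
Proof.
  intros H; apply Rsqr_incr_0_var; [| apply Cmod_ge_0].
  rewrite !Rsqr_pow2; exact H.
Qed.

Lemma hol_intro (D : C -> Prop) (f df : C -> C) (M : R) :
  (forall z, D z -> Cmod (f z) <= M) ->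
  (forall z, D z -> Cmod (df z) <= M) ->
  (forall z z', D z -> D z' ->
     Cmod (f z' - f z - df z * (z' - z)) <= M * Cmod (z' - z) ^ 2) ->
  hol D f df.
Proof. intros H1 H2 H3; exists M; intros z Hz; auto. Qed.

(** [D] need not be convex, so Lipschitz bounds cannot come from integrating along segments. For
    [f], distances up to 1 use the expansion and larger ones the bound on the values, whence the
    factor 2. For [df], adding the expansions at [z] and at [z'] leaves [(df z' - df z) * (z' - z)],
    which is therefore quadratically small. *)
Lemma hol_bounds (D : C -> Prop) (f df : C -> C) :
  hol D f df -> exists M, 0 <= M /\
    (forall z, D z -> Cmod (f z) <= M) /\
    (forall z, D z -> Cmod (df z) <= M) /\
    (forall z z', D z -> D z' ->
       Cmod (f z' - f z - df z * (z' - z)) <= M * Cmod (z' - z) ^ 2) /\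
    (forall z z', D z -> D z' -> Cmod (f z' - f z) <= M * Cmod (z' - z)) /\
    (forall z z', D z -> D z' -> Cmod (df z' - df z) <= M * Cmod (z' - z)).
Proof.
  intros [M H].
  exists (2 * Rmax M 0).
  assert (H0 := Rmax_r M 0); assert (H1 := Rmax_l M 0).
  set (N := Rmax M 0) in *; clearbody N.
  assert (Hf : forall z, D z -> Cmod (f z) <= N)
    by (intros z Hz; destruct (H z Hz); lra).
  assert (Hd : forall z, D z -> Cmod (df z) <= N)
    by (intros z Hz; destruct (H z Hz) as (_ & ? & _); lra).
  assert (Hr : forall z z', D z -> D z' ->
       Cmod (f z' - f z - df z * (z' - z)) <= N * Cmod (z' - z) ^ 2).
  { intros z z' Hz Hz'; destruct (H z Hz) as (_ & _ & H2).
    specialize (H2 z' Hz'). assert (H3 := pow2_ge_0 (Cmod (z' - z))). nra. }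
  split; [lra|]. split; [intros; specialize (Hf z H2); lra|].
  split; [intros; specialize (Hd z H2); lra|].
  split; [intros z z' Hz Hz'; specialize (Hr z z' Hz Hz');
          assert (H3 := pow2_ge_0 (Cmod (z' - z))); nra|].
  split; intros z z' Hz Hz'; specialize (Hr z z' Hz Hz') as Hr1;
    specialize (Hr z' z Hz' Hz) as Hr2; assert (Hp := Cmod_ge_0 (z' - z)).
  - destruct (Rle_lt_dec (Cmod (z' - z)) 1) as [Hs|Hs].
    + replace (f z' - f z)%C
        with ((f z' - f z - df z * (z' - z)) + df z * (z' - z))%C by ring.
      eapply Rle_trans; [apply Cmod_triangle|].
      rewrite Cmod_mult. specialize (Hd z Hz).
      set (d := Cmod (z' - z)) in *.
      assert (Cmod (df z) * d <= N * d) by (apply Rmult_le_compat_r; auto).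
      assert (N * d ^ 2 <= N * d) by (apply Rmult_le_compat_l; nra).
      lra.
    + eapply Rle_trans; [apply Cmod_triangle|].
      rewrite Cmod_opp. pose proof (Hf z Hz); pose proof (Hf z' Hz'). nra.
  - rewrite (Cmod_minus_sym z z') in Hr2.
    destruct (Req_dec (Cmod (z' - z)) 0) as [He|Hne].
    + apply Cmod_eq_0 in He.
      assert (z' = z) by (replace z' with (z' - z + z)%C by ring; rewrite He; ring).
      subst. replace (df z - df z)%C with (RtoC 0) by ring. rewrite Cmod_0.
      replace (z - z)%C with (RtoC 0) by ring. rewrite Cmod_0; lra.
    + apply Rmult_le_reg_r with (Cmod (z' - z)); [lra|].
      rewrite <- Cmod_mult.
      replace ((df z' - df z) * (z' - z))%C
        with ((f z' - f z - df z * (z' - z)) +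
              (f z - f z' - df z' * (z - z')))%C by ring.
      eapply Rle_trans; [apply Cmod_triangle|]. nra.
Qed.

Lemma hol_subset (D E : C -> Prop) (f df : C -> C) :
  (forall z, D z -> E z) -> hol E f df -> hol D f df.
Proof.
  intros He [M H]; exists M; intros z Hz.
  destruct (H z (He z Hz)) as (H1 & H2 & H3); auto.
Qed.

Lemma hol_const (D : C -> Prop) (a : C) : hol D (fun _ => a) (fun _ => RtoC 0).
Proof.
  apply hol_intro with (Cmod a); intros.
  - lra.
  - rewrite Cmod_0; apply Cmod_ge_0.
  - replace (a - a - 0 * (z' - z))%C with (RtoC 0) by ring. rewrite Cmod_0.
    apply Rmult_le_pos; [apply Cmod_ge_0 | apply pow2_ge_0].
Qed.

Lemma hol_id (D : C -> Prop) (R0 : R) :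
  (forall z, D z -> Cmod z <= R0) -> hol D (fun z => z) (fun _ => RtoC 1).
Proof.
  intros HD; apply hol_intro with (Rmax R0 1); intros.
  - eapply Rle_trans; [apply HD; auto | apply Rmax_l].
  - rewrite Cmod_1; apply Rmax_r.
  - replace (z' - z - 1 * (z' - z))%C with (RtoC 0) by ring. rewrite Cmod_0.
    apply Rmult_le_pos; [|apply pow2_ge_0].
    eapply Rle_trans; [|apply Rmax_r]; lra.
Qed.

Lemma hol_plus (D : C -> Prop) (f df g dg : C -> C) :
  hol D f df -> hol D g dg ->
  hol D (fun z => f z + g z)%C (fun z => df z + dg z)%C.
Proof.
  intros [M H] [N H']; exists (M + N); intros z Hz.
  destruct (H z Hz) as (H1 & H2 & H3), (H' z Hz) as (H1' & H2' & H3').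
  split; [eapply Rle_trans; [apply Cmod_triangle|lra]|].
  split; [eapply Rle_trans; [apply Cmod_triangle|lra]|].
  intros z' Hz'; specialize (H3 z' Hz'); specialize (H3' z' Hz').
  replace (f z' + g z' - (f z + g z) - (df z + dg z) * (z' - z))%C
    with ((f z' - f z - df z * (z' - z)) + (g z' - g z - dg z * (z' - z)))%C
    by ring.
  eapply Rle_trans; [apply Cmod_triangle|lra].
Qed.

Lemma hol_mult (D : C -> Prop) (f df g dg : C -> C) :
  hol D f df -> hol D g dg ->
  hol D (fun z => f z * g z)%C (fun z => df z * g z + f z * dg z)%C.
Proof.
  intros H H'.
  destruct (hol_bounds _ _ _ H) as (M & M0 & Mf & Md & Mr & Ml & _).
  destruct (hol_bounds _ _ _ H') as (N & N0 & Nf & Nd & Nr & Nl & _).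
  apply hol_intro with (3 * M * N).
  - intros z Hz; rewrite Cmod_mult.
    specialize (Mf z Hz); specialize (Nf z Hz).
    assert (0 <= Cmod (f z)) by apply Cmod_ge_0.
    assert (0 <= Cmod (g z)) by apply Cmod_ge_0. nra.
  - intros z Hz; eapply Rle_trans; [apply Cmod_triangle|]; rewrite !Cmod_mult.
    specialize (Mf z Hz); specialize (Nf z Hz);
      specialize (Md z Hz); specialize (Nd z Hz).
    assert (0 <= Cmod (f z)) by apply Cmod_ge_0.
    assert (0 <= Cmod (g z)) by apply Cmod_ge_0.
    assert (0 <= Cmod (df z)) by apply Cmod_ge_0.
    assert (0 <= Cmod (dg z)) by apply Cmod_ge_0. nra.
  - intros z z' Hz Hz'.
    replace (f z' * g z' - f z * g z - (df z * g z + f z * dg z) * (z' - z))%C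
      with ((f z' - f z - df z * (z' - z)) * g z'
            + f z * (g z' - g z - dg z * (z' - z))
            + df z * (z' - z) * (g z' - g z))%C by ring.
    eapply Rle_trans; [apply Cmod_triangle|].
    eapply Rle_trans; [apply Rplus_le_compat_r, Cmod_triangle|].
    rewrite !Cmod_mult.
    specialize (Mr z z' Hz Hz'); specialize (Nr z z' Hz Hz');
    specialize (Nl z z' Hz Hz'); specialize (Mf z Hz); specialize (Nf z' Hz');
      specialize (Md z Hz).
    assert (Hp := Cmod_ge_0 (z' - z)); set (h := Cmod (z' - z)) in *.
    assert (E1 : Cmod (f z' - f z - df z * (z' - z)) * Cmod (g z')
                 <= M * h ^ 2 * N)
      by (apply Rmult_le_compat; auto using Cmod_ge_0).
    assert (E2 : Cmod (f z) * Cmod (g z' - g z - dg z * (z' - z))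
                 <= M * (N * h ^ 2))
      by (apply Rmult_le_compat; auto using Cmod_ge_0).
    assert (E3 : Cmod (df z) * h * Cmod (g z' - g z) <= M * h * (N * h)).
    { apply Rmult_le_compat; auto using Cmod_ge_0.
      - apply Rmult_le_pos; auto using Cmod_ge_0.
      - apply Rmult_le_compat_r; auto. }
    lra.
Qed.

Lemma hol_inv (D : C -> Prop) (f df : C -> C) (c : R) :
  0 < c -> (forall z, D z -> c <= Cmod (f z)) -> hol D f df ->
  hol D (fun z => / f z)%C (fun z => - df z * (/ f z * / f z))%C.
Proof.
  intros Hc Hlow H.
  destruct (hol_bounds _ _ _ H) as (M & M0 & Mf & Md & Mr & Ml & _).
  assert (Hn : forall z, D z -> f z <> 0%C).
  { intros z Hz He; specialize (Hlow z Hz); rewrite He, Cmod_0 in Hlow; lra. }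
  set (k := / c).
  assert (Hk : 0 < k) by (apply Rinv_0_lt_compat; auto).
  assert (Hi : forall z, D z -> Cmod (/ f z) <= k).
  { intros z Hz; rewrite Cmod_inv by auto; apply Rinv_le_contravar; auto. }
  assert (Hi2 : forall z, D z -> Cmod (/ f z * / f z) <= k * k).
  { intros z Hz; rewrite Cmod_mult.
    apply Rmult_le_compat; auto using Cmod_ge_0. }
  set (B := M * (k * k) + 2 * (M * M * (k * k * k))).
  assert (HB1 : 0 <= M * (k * k)) by (apply Rmult_le_pos; nra).
  assert (HB2 : 0 <= M * M * (k * k * k))
    by (apply Rmult_le_pos; [nra | apply Rmult_le_pos; nra]).
  apply hol_intro with (B + k); unfold B.
  - intros z Hz; specialize (Hi z Hz); lra.
  - intros z Hz; rewrite Cmod_mult, Cmod_opp.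
    assert (Cmod (df z) * Cmod (/ f z * / f z) <= M * (k * k))
      by (apply Rmult_le_compat; auto using Cmod_ge_0).
    lra.
  - intros z z' Hz Hz'.
    replace (/ f z' - / f z - - df z * (/ f z * / f z) * (z' - z))%C
      with (- ((f z' - f z - df z * (z' - z)) * (/ f z * / f z))
            + ((f z' - f z) * (f z' - f z)) * ((/ f z * / f z) * / f z'))%C
      by (field; auto).
    eapply Rle_trans; [apply Cmod_triangle|].
    rewrite Cmod_opp, !(Cmod_mult _ (_ * _)), (Cmod_mult (_ * _) (/ f z')),
      (Cmod_mult (f z' - f z) (f z' - f z)).
    specialize (Mr z z' Hz Hz'); specialize (Ml z z' Hz Hz').
    assert (Hp := Cmod_ge_0 (z' - z)); set (h := Cmod (z' - z)) in *.
    assert (E1 : Cmod (f z' - f z - df z * (z' - z)) * Cmod (/ f z * / f z)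
                 <= M * h ^ 2 * (k * k))
      by (apply Rmult_le_compat; auto using Cmod_ge_0).
    assert (E2 : Cmod (f z' - f z) * Cmod (f z' - f z) *
                 (Cmod (/ f z * / f z) * Cmod (/ f z'))
                 <= (M * h) * (M * h) * (k * k * k)).
    { apply Rmult_le_compat.
      - apply Rmult_le_pos; auto using Cmod_ge_0.
      - apply Rmult_le_pos; auto using Cmod_ge_0.
      - apply Rmult_le_compat; auto using Cmod_ge_0.
      - apply Rmult_le_compat; auto using Cmod_ge_0. }
    assert (0 <= M * M * (k * k * k) * h ^ 2)
      by (apply Rmult_le_pos; [auto | apply pow2_ge_0]).
    assert (0 <= k * h ^ 2) by (apply Rmult_le_pos; [lra | apply pow2_ge_0]).
    nra.
Qed.

Lemma hol_comp (D E : C -> Prop) (f df g dg : C -> C) :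
  (forall z, D z -> E (g z)) -> hol E f df -> hol D g dg ->
  hol D (fun z => f (g z)) (fun z => df (g z) * dg z)%C.
Proof.
  intros HDE H H'.
  destruct (hol_bounds _ _ _ H) as (M & M0 & Mf & Md & Mr & Ml & _).
  destruct (hol_bounds _ _ _ H') as (N & N0 & Nf & Nd & Nr & Nl & _).
  assert (0 <= M * N) by nra. assert (0 <= M * (N * N)) by nra.
  apply hol_intro with (M + M * N + M * (N * N)).
  - intros z Hz; specialize (Mf _ (HDE _ Hz)); lra.
  - intros z Hz; rewrite Cmod_mult.
    assert (Cmod (df (g z)) * Cmod (dg z) <= M * N)
      by (apply Rmult_le_compat; auto using Cmod_ge_0).
    lra.
  - intros z z' Hz Hz'.
    replace (f (g z') - f (g z) - df (g z) * dg z * (z' - z))%C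
      with ((f (g z') - f (g z) - df (g z) * (g z' - g z))
            + df (g z) * (g z' - g z - dg z * (z' - z)))%C by ring.
    eapply Rle_trans; [apply Cmod_triangle|]; rewrite (Cmod_mult (df (g z))).
    specialize (Mr _ _ (HDE _ Hz) (HDE _ Hz')); specialize (Nl z z' Hz Hz');
      specialize (Nr z z' Hz Hz').
    assert (Hp := Cmod_ge_0 (z' - z)); set (h := Cmod (z' - z)) in *.
    assert (E2 : Cmod (df (g z)) * Cmod (g z' - g z - dg z * (z' - z))
                 <= M * (N * h ^ 2))
      by (apply Rmult_le_compat; auto using Cmod_ge_0).
    assert (E1 : Cmod (g z' - g z) ^ 2 <= (N * h) ^ 2)
      by (apply pow_incr; split; auto using Cmod_ge_0).
    assert (M * Cmod (g z' - g z) ^ 2 <= M * (N * h) ^ 2)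
      by (apply Rmult_le_compat_l; auto).
    assert (0 <= M * h ^ 2) by (apply Rmult_le_pos; [lra | apply pow2_ge_0]).
    nra.
Qed.

(* [p y' - p y = (y' - y) * Q y y'] with [Q] Lipschitz and bounded away from 0
   makes any section of [p] holomorphic. *)
Lemma hol_section (D Y : C -> Prop) (p inv : C -> C) (Q : C -> C -> C)
  (B c L : R) :
  0 < c -> 0 <= L ->
  (forall y, Y y -> Cmod y <= B) ->
  (forall y y', Y y -> Y y' -> p y' - p y = (y' - y) * Q y y')%C ->
  (forall y y', Y y -> Y y' -> c <= Cmod (Q y y')) ->
  (forall y y', Y y -> Y y' -> Cmod (Q y y' - Q y y) <= L * Cmod (y' - y)) ->
  (forall v, D v -> Y (inv v) /\ p (inv v) = v) ->
  hol D inv (fun v => / Q (inv v) (inv v))%C.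
Proof.
  intros Hc HL HB Hp Hlow HLip Hinv.
  set (k := / c).
  assert (Hk : 0 < k) by (apply Rinv_0_lt_compat; auto).
  assert (Hn : forall y y', Y y -> Y y' -> Q y y' <> 0%C).
  { intros y y' Hy Hy' He; specialize (Hlow y y' Hy Hy');
      rewrite He, Cmod_0 in Hlow; lra. }
  assert (Hi : forall y y', Y y -> Y y' -> Cmod (/ Q y y') <= k).
  { intros y y' Hy Hy'; rewrite Cmod_inv by auto.
    apply Rinv_le_contravar; auto. }
  assert (HE : 0 <= L * (k * k * k)) by (apply Rmult_le_pos; nra).
  apply hol_intro with (Rabs B + k + L * (k * k * k)).
  - intros v Hv; destruct (Hinv v Hv) as [Hy _]; specialize (HB _ Hy).
    assert (H := Rle_abs B); lra.
  - intros v Hv; destruct (Hinv v Hv) as [Hy _]; specialize (Hi _ _ Hy Hy).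
    assert (H := Rabs_pos B); lra.
  - intros v v' Hv Hv'.
    destruct (Hinv v Hv) as [Hy Ey], (Hinv v' Hv') as [Hy' Ey'].
    rewrite <- Ey at 4; rewrite <- Ey' at 2.
    set (y := inv v) in *; set (y' := inv v') in *.
    assert (Hd : Cmod (y' - y) <= k * Cmod (v' - v)).
    { rewrite <- Ey, <- Ey', (Hp y y' Hy Hy'), Cmod_mult.
      specialize (Hlow y y' Hy Hy').
      assert (0 <= Cmod (y' - y)) by apply Cmod_ge_0.
      apply Rmult_le_reg_l with c; auto. unfold k.
      replace (c * (/ c * (Cmod (y' - y) * Cmod (Q y y'))))
        with (Cmod (y' - y) * Cmod (Q y y')) by (field; lra).
      nra. }
    rewrite (Hp y y' Hy Hy').
    replace (y' - y - / Q y y * ((y' - y) * Q y y'))%C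
      with (- (/ Q y y * ((y' - y) * (Q y y' - Q y y))))%C
      by (field; auto).
    rewrite Cmod_opp, !Cmod_mult.
    specialize (HLip y y' Hy Hy'); specialize (Hi y y Hy Hy).
    assert (Hpos := Cmod_ge_0 (v' - v)); set (h := Cmod (v' - v)) in *.
    assert (H0 := Cmod_ge_0 (y' - y)); set (d := Cmod (y' - y)) in *.
    assert (E1 : d * Cmod (Q y y' - Q y y) <= d * (L * d))
      by (apply Rmult_le_compat_l; auto).
    assert (E2 : d * (L * d) <= (k * h) * (L * (k * h))).
    { apply Rmult_le_compat; auto; [nra|]. apply Rmult_le_compat_l; auto. }
    assert (E3 : Cmod (/ Q y y) * (d * Cmod (Q y y' - Q y y))
                 <= k * ((k * h) * (L * (k * h)))).
    { apply Rmult_le_compat; auto using Cmod_ge_0; [|lra].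
      apply Rmult_le_pos; auto using Cmod_ge_0. }
    assert (0 <= Rabs B * h ^ 2)
      by (apply Rmult_le_pos; [apply Rabs_pos | apply pow2_ge_0]).
    assert (0 <= k * h ^ 2) by (apply Rmult_le_pos; [lra | apply pow2_ge_0]).
    nra.
Qed.

(** * The mean value property *)

Definition closed_disc (r : R) (z : C) : Prop := Cmod z <= r.

Definition circle (r t : R) : C := (r * cos t, r * sin t).

Lemma Cmod_circle (r t : R) : 0 <= r -> Cmod (circle r t) = r.
Proof.
  intros Hr; unfold Cmod, circle; simpl.
  replace (r * cos t * (r * cos t * 1) + r * sin t * (r * sin t * 1))
    with (r ^ 2 * (Rsqr (sin t) + Rsqr (cos t))) by (unfold Rsqr; ring).
  rewrite sin2_cos2, Rmult_1_r, sqrt_pow2; auto.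
Qed.

Lemma circle_in_disc (r s t : R) : 0 <= r <= s -> closed_disc s (circle r t).
Proof. intros H; unfold closed_disc; rewrite Cmod_circle; lra. Qed.

Lemma circle_scal (r t : R) : circle r t = (RtoC r * circle 1 t)%C.
Proof. unfold circle, Cmult, RtoC; simpl; f_equal; ring. Qed.

Lemma fst_le_Cmod (z : C) : Rabs (fst z) <= Cmod z.
Proof. eapply Rle_trans; [apply Rmax_l | apply Rmax_Cmod]. Qed.

Lemma snd_le_Cmod (z : C) : Rabs (snd z) <= Cmod z.
Proof. eapply Rle_trans; [apply Rmax_r | apply Rmax_Cmod]. Qed.

Lemma Cmod_le_add (z : C) : Cmod z <= Rabs (fst z) + Rabs (snd z).
Proof.
  assert (H1 := Rabs_pos (fst z)); assert (H2 := Rabs_pos (snd z)).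
  apply Cmod_le_of_sq; [lra|].
  rewrite <- (pow2_abs (fst z)), <- (pow2_abs (snd z)); nra.
Qed.

Lemma abs_sin_le (u : R) : Rabs (sin u) <= Rabs u.
Proof.
  destruct (MVT_gen sin 0 u cos) as (c & _ & Hc).
  - intros; apply is_derive_sin.
  - intros; apply continuity_sin.
  - rewrite sin_0, !Rminus_0_r in Hc; rewrite Hc, Rabs_mult.
    assert (Rabs (cos c) <= 1) by (apply Rabs_le, COS_bound).
    assert (H1 := Rabs_pos u); nra.
Qed.

Lemma abs_cos_sub_one_le (u : R) : Rabs (cos u - 1) <= u ^ 2.
Proof.
  replace u with (2 * (u / 2)) at 1 by field.
  rewrite cos_2a_sin.
  replace (1 - 2 * sin (u / 2) * sin (u / 2) - 1)
    with (- (2 * sin (u / 2) ^ 2)) by ring.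
  rewrite Rabs_Ropp, Rabs_right
    by (apply Rle_ge; assert (H := pow2_ge_0 (sin (u/2))); lra).
  assert (H := abs_sin_le (u / 2)).
  apply pow_maj_Rabs with (n := 2%nat) in H.
  rewrite pow2_abs in H. assert (H0 := pow2_ge_0 u). nra.
Qed.

Lemma abs_sin_sub_id_le (u : R) : Rabs (sin u - u) <= u ^ 2.
Proof.
  destruct (MVT_gen (fun u => sin u - u) 0 u (fun u => cos u - 1))
    as (c & Hc & He).
  - intros; auto_derive; auto; ring.
  - intros; apply continuity_pt_minus;
      [apply continuity_sin | apply derivable_continuous, derivable_id].
  - rewrite sin_0, !Rminus_0_r in He; rewrite He, Rabs_mult.
    assert (Hcu : Rabs c <= Rabs u).
    { revert Hc; unfold Rmin, Rmax; destruct (Rle_dec 0 u); intros.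
      - rewrite !Rabs_right; lra.
      - rewrite !Rabs_left1; lra. }
    assert (Hc1 : Rabs (cos c - 1) <= Rabs c).
    { destruct (MVT_gen cos 0 c (fun u => - sin u)) as (e & _ & Hd).
      - intros; apply is_derive_cos.
      - intros; apply continuity_cos.
      - rewrite cos_0, !Rminus_0_r in Hd; rewrite Hd, Rabs_mult, Rabs_Ropp.
        assert (Rabs (sin e) <= 1) by (apply Rabs_le, SIN_bound).
        assert (H1 := Rabs_pos c); nra. }
    rewrite <- pow2_abs; assert (H1 := Rabs_pos u); nra.
Qed.

Lemma circle_expansion (r t t' : R) : 0 <= r ->
  Cmod (circle r t' - circle r t - Ci * circle r t * RtoC (t' - t))
  <= 2 * r * (t' - t) ^ 2.
Proof.
  intros Hr; set (u := t' - t).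
  replace t' with (t + u) by (unfold u; ring).
  replace (circle r (t + u) - circle r t - Ci * circle r t * RtoC u)%C
    with (circle r t * (cos u - 1, sin u - u)%R)%C.
  - rewrite Cmod_mult, Cmod_circle by auto.
    replace (2 * r * u ^ 2) with (r * (u ^ 2 + u ^ 2)) by ring.
    apply Rmult_le_compat_l; auto.
    eapply Rle_trans; [apply Cmod_le_add|].
    apply Rplus_le_compat; [apply abs_cos_sub_one_le | apply abs_sin_sub_id_le].
  - unfold circle; rewrite cos_plus, sin_plus.
    unfold Ci, RtoC, Cmult, Cminus, Cplus, Copp; simpl; f_equal; ring.
Qed.

Lemma circle_lipschitz (r t t' : R) : 0 <= r ->
  Cmod (circle r t' - circle r t) <= 4 * r * Rabs (t' - t).
Proof.
  intros Hr.
  assert (HA := Rabs_pos (t' - t)).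
  destruct (Rle_lt_dec (Rabs (t' - t)) 1) as [H|H].
  - replace (circle r t' - circle r t)%C
      with ((circle r t' - circle r t - Ci * circle r t * RtoC (t' - t))
            + Ci * circle r t * RtoC (t' - t))%C by ring.
    eapply Rle_trans; [apply Cmod_triangle|].
    rewrite !Cmod_mult, Cmod_Ci, Cmod_R, Cmod_circle by auto.
    assert (H1 := circle_expansion r t t' Hr).
    rewrite <- pow2_abs in H1. set (h := Rabs (t' - t)) in *.
    assert (2 * r * h ^ 2 <= 2 * r * h) by (apply Rmult_le_compat_l; nra).
    nra.
  - eapply Rle_trans; [apply Cmod_triangle|].
    rewrite Cmod_opp, !Cmod_circle by auto. nra.
Qed.

Lemma is_derive_of_quadratic (g : R -> R) (t l M : R) :
  (forall t', Rabs (g t' - g t - l * (t' - t)) <= M * (t' - t) ^ 2) ->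
  is_derive g t l.
Proof.
  intros H; apply is_derive_Reals; intros eps He.
  assert (HM : 0 < Rabs M + 1) by (assert (H0 := Rabs_pos M); lra).
  assert (Hd : 0 < eps / (Rabs M + 1)) by (apply Rdiv_lt_0_compat; auto).
  exists (mkposreal _ Hd); intros h Hh Hlt; simpl in Hlt.
  specialize (H (t + h)); replace (t + h - t) with h in H by ring.
  replace ((g (t + h) - g t) / h - l) with ((g (t + h) - g t - l * h) / h)
    by (field; auto).
  unfold Rdiv; rewrite Rabs_mult, Rabs_inv.
  assert (Hp : 0 < Rabs h) by (apply Rabs_pos_lt; auto).
  apply Rmult_lt_reg_r with (Rabs h); auto.
  rewrite Rmult_assoc, Rinv_l, Rmult_1_r by lra.
  eapply Rle_lt_trans; [apply H|]. rewrite <- pow2_abs.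
  assert (H2 : Rabs h * (Rabs M + 1) < eps).
  { apply Rmult_lt_compat_r with (r := Rabs M + 1) in Hlt; auto.
    unfold Rdiv in Hlt; rewrite Rmult_assoc, Rinv_l, Rmult_1_r in Hlt; lra. }
  assert (H3 := Rle_abs M). nra.
Qed.

Lemma continuous_of_lipschitz (g : R -> R) (t M : R) :
  (forall t', Rabs (g t' - g t) <= M * Rabs (t' - t)) ->
  continuous g t.
Proof.
  intros H; apply continuity_pt_filterlim.
  intros eps He.
  assert (HM : 0 < Rabs M + 1) by (assert (H0 := Rabs_pos M); lra).
  exists (eps / (Rabs M + 1)); split; [apply Rdiv_lt_0_compat; auto|].
  intros t' [_ Hlt]; simpl in *; unfold Rdist in *.
  eapply Rle_lt_trans; [apply H|].
  apply Rmult_lt_compat_r with (r := Rabs M + 1) in Hlt; auto.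
  unfold Rdiv in Hlt; rewrite Rmult_assoc, Rinv_l, Rmult_1_r in Hlt by lra.
  assert (H3 := Rle_abs M). assert (H4 := Rabs_pos (t' - t)). nra.
Qed.

Lemma hol_circle_continuous (r : R) (f df : C -> C) (t : R) :
  0 <= r -> hol (closed_disc r) f df ->
  continuous (fun t => fst (f (circle r t))) t /\
  continuous (fun t => fst (df (circle r t) * circle 1 t)%C) t.
Proof.
  intros Hr H; destruct (hol_bounds _ _ _ H) as (M & M0 & Mf & Md & Mr & Ml & Mc).
  assert (HD : forall t, closed_disc r (circle r t))
    by (intros; apply circle_in_disc; lra).
  split.
  - apply continuous_of_lipschitz with (M * (4 * r)); intros t'.
    replace (fst (f (circle r t')) - fst (f (circle r t)))
      with (fst (f (circle r t') - f (circle r t))%C) by (simpl; ring).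
    eapply Rle_trans; [apply fst_le_Cmod|].
    eapply Rle_trans; [apply Ml; auto|]. rewrite Rmult_assoc.
    apply Rmult_le_compat_l; auto. apply circle_lipschitz; auto.
  - apply continuous_of_lipschitz with (M * (4 * r) + M * 4); intros t'.
    replace (fst (df (circle r t') * circle 1 t')%C
             - fst (df (circle r t) * circle 1 t)%C)
      with (fst ((df (circle r t') - df (circle r t)) * circle 1 t'
                 + df (circle r t) * (circle 1 t' - circle 1 t))%C)
      by (simpl; ring).
    eapply Rle_trans; [apply fst_le_Cmod|].
    eapply Rle_trans; [apply Cmod_triangle|].
    rewrite !Cmod_mult, Cmod_circle, Rmult_1_r, Rmult_plus_distr_r by lra.
    apply Rplus_le_compat.
    + eapply Rle_trans; [apply Mc; auto|]. rewrite Rmult_assoc.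
      apply Rmult_le_compat_l; auto. apply circle_lipschitz; auto.
    + rewrite (Rmult_assoc M 4).
      apply Rmult_le_compat; auto using Cmod_ge_0.
      eapply Rle_trans; [apply circle_lipschitz; lra|]. lra.
Qed.

Lemma hol_subdisc (r s : R) (f df : C -> C) :
  r <= s -> hol (closed_disc s) f df -> hol (closed_disc r) f df.
Proof. intros H; apply hol_subset; unfold closed_disc; intros; lra. Qed.

(* [Im f (r e^it) / r] is a primitive of the integrand *)
Lemma RInt_radial_derivative (r : R) (f df : C -> C) :
  0 < r -> hol (closed_disc r) f df ->
  is_RInt (fun t => fst (df (circle r t) * circle 1 t)%C) 0 (2 * PI) 0.
Proof.
  intros Hr H.
  set (g := fun t => snd (f (circle r t)) / r).
  assert (E : minus (g (2 * PI)) (g 0) = 0).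
  { unfold g, circle; rewrite cos_2PI, sin_2PI, cos_0, sin_0.
    apply Rminus_diag_eq; reflexivity. }
  refine (eq_ind _ (fun v => is_RInt _ 0 (2 * PI) v) _ 0 E).
  apply (is_RInt_derive (V := R_CompleteNormedModule)).
  2:{ intros; apply (hol_circle_continuous r f df); auto; lra. }
  intros t _.
  destruct (hol_bounds _ _ _ H) as (M & M0 & Mf & Md & Mr & Ml & Mc).
  assert (HD : forall t, closed_disc r (circle r t))
    by (intros; apply circle_in_disc; lra).
  apply is_derive_of_quadratic
    with (/ r * (M * (4 * r) ^ 2 + M * (2 * r))).
  intros t'.
  replace (g t' - g t - fst (df (circle r t) * circle 1 t)%C * (t' - t))
    with (/ r * snd (f (circle r t') - f (circle r t)
             - df (circle r t) * (Ci * circle r t * RtoC (t' - t)))%C)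
    by (unfold g, circle; simpl; field; lra).
  rewrite Rabs_mult, Rabs_inv, (Rabs_right r), Rmult_assoc by lra.
  apply Rmult_le_compat_l; [apply Rlt_le, Rinv_0_lt_compat; auto|].
  eapply Rle_trans; [apply snd_le_Cmod|].
  replace (f (circle r t') - f (circle r t)
           - df (circle r t) * (Ci * circle r t * RtoC (t' - t)))%C
    with ((f (circle r t') - f (circle r t)
           - df (circle r t) * (circle r t' - circle r t))
          + df (circle r t) * (circle r t' - circle r t
                               - Ci * circle r t * RtoC (t' - t)))%C by ring.
  eapply Rle_trans; [apply Cmod_triangle|].
  rewrite (Cmod_mult (df _)), Rmult_plus_distr_r.
  apply Rplus_le_compat.
  - eapply Rle_trans; [apply Mr; auto|]. rewrite Rmult_assoc.
    apply Rmult_le_compat_l; auto.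
    rewrite <- (pow2_abs (t' - t)), <- Rpow_mult_distr.
    apply pow_incr; split; [apply Cmod_ge_0|].
    apply circle_lipschitz; lra.
  - rewrite (Rmult_assoc M). apply Rmult_le_compat; auto using Cmod_ge_0.
    apply circle_expansion; lra.
Qed.

(** Cutting [[0, R0]] into n equal steps bounds the total increment by K R0^2 / n. This takes the
    place of differentiating under the integral sign. *)
Lemma constant_of_quadratic_modulus (I : R -> R) (R0 K : R) :
  0 <= R0 ->
  (forall r s, 0 <= r <= R0 -> 0 <= s <= R0 ->
     Rabs (I s - I r) <= K * (s - r) ^ 2) ->
  I R0 = I 0.
Proof.
  intros HR H.
  assert (Hn : forall n, (0 < n)%nat -> forall k, (k <= n)%nat ->
    Rabs (I (INR k * (R0 / INR n)) - I 0) <= INR k * (K * (R0 / INR n) ^ 2)).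
  { intros n Hn. assert (Hn' : 0 < INR n) by (apply lt_0_INR; auto).
    assert (Hd : 0 <= R0 / INR n)
      by (apply Rmult_le_pos; [auto | apply Rlt_le, Rinv_0_lt_compat; auto]).
    assert (Hin : forall k, (k <= n)%nat -> 0 <= INR k * (R0 / INR n) <= R0).
    { intros k Hk; apply le_INR in Hk; assert (Hk0 := pos_INR k).
      split; [apply Rmult_le_pos; auto|].
      replace R0 with (INR n * (R0 / INR n)) at 2 by (field; lra).
      apply Rmult_le_compat_r; auto. }
    induction k as [|k IH]; intros Hk.
    - simpl; rewrite !Rmult_0_l.
      unfold Rminus; rewrite Rplus_opp_r, Rabs_R0; lra.
    - replace (I (INR (S k) * (R0 / INR n)) - I 0)
        with ((I (INR (S k) * (R0 / INR n)) - I (INR k * (R0 / INR n)))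
              + (I (INR k * (R0 / INR n)) - I 0)) by ring.
      eapply Rle_trans; [apply Rabs_triang|].
      specialize (IH ltac:(lia)).
      assert (H1 := H _ _ (Hin k ltac:(lia)) (Hin (S k) Hk)).
      rewrite S_INR in *.
      replace ((INR k + 1) * (R0 / INR n) - INR k * (R0 / INR n))
        with (R0 / INR n) in H1 by ring.
      lra. }
  destruct (Req_dec (I R0 - I 0) 0) as [He|Hne]; [lra|exfalso].
  assert (Hp : 0 < Rabs (I R0 - I 0)) by (apply Rabs_pos_lt; auto).
  assert (HK : 0 <= Rabs K * R0 ^ 2)
    by (apply Rmult_le_pos; [apply Rabs_pos | apply pow2_ge_0]).
  destruct (archimed_cor1 (Rabs (I R0 - I 0) / (Rabs K * R0 ^ 2 + 1)))
    as (n & Hlt & Hn0); [apply Rdiv_lt_0_compat; lra|].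
  assert (Hn' : 0 < INR n) by (apply lt_0_INR; auto).
  assert (H1 := Hn n Hn0 n (le_n n)).
  replace (INR n * (R0 / INR n)) with R0 in H1 by (field; lra).
  replace (INR n * (K * (R0 / INR n) ^ 2)) with (K * R0 ^ 2 * / INR n) in H1
    by (field; lra).
  assert (Hi : 0 < / INR n) by (apply Rinv_0_lt_compat; auto).
  apply Rmult_lt_compat_r with (r := Rabs K * R0 ^ 2 + 1) in Hlt; [|lra].
  unfold Rdiv in Hlt; rewrite Rmult_assoc, Rinv_l, Rmult_1_r in Hlt by lra.
  assert (K * R0 ^ 2 <= Rabs K * R0 ^ 2)
    by (apply Rmult_le_compat_r; [apply pow2_ge_0 | apply Rle_abs]).
  nra.
Qed.

(** The circle mean [I s] has a quadratic modulus: the linear term of the expansion of [f] along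
    each ray integrates to 0 by [RInt_radial_derivative], and the quadratic error is uniform in the
    angle. So [I] is constant, and [I 0] is evaluation at the centre. *)
Lemma mean_value_property (r : R) (f df : C -> C) :
  0 < r -> hol (closed_disc r) f df ->
  is_RInt (fun t => fst (f (circle r t))) 0 (2 * PI) (2 * PI * fst (f 0%C)).
Proof.
  intros Hr H.
  set (I := fun s => RInt (fun t => fst (f (circle s t))) 0 (2 * PI)).
  assert (Hex : forall s, 0 <= s <= r ->
            ex_RInt (fun t => fst (f (circle s t))) 0 (2 * PI)).
  { intros s Hs; apply (ex_RInt_continuous (V := R_CompleteNormedModule)); intros t _.
    apply (hol_circle_continuous s f df); [lra|].
    apply hol_subdisc with r; auto; lra. }
  assert (HI0 : I 0 = 2 * PI * fst (f 0%C)).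
  { unfold I; rewrite (RInt_ext _ (fun _ => fst (f 0%C))).
    - rewrite RInt_const; unfold scal; simpl; unfold mult; simpl; ring.
    - intros t _; unfold circle; rewrite !Rmult_0_l; reflexivity. }
  assert (HIr : I r = I 0).
  { destruct (hol_bounds _ _ _ H) as (M & M0 & Mf & Md & Mr & Ml & Mc).
    assert (Hlt : forall s s', 0 <= s' <= r -> 0 < s <= r ->
              Rabs (I s' - I s) <= 2 * PI * M * (s' - s) ^ 2).
    { intros s s' Hs' Hs.
      assert (H1 : is_RInt (fun t => fst (f (circle s' t) - f (circle s t)
                     - df (circle s t) * (circle s' t - circle s t))%C)
                     0 (2 * PI) (I s' - I s)).
      { replace (I s' - I s) with (minus (minus (I s') (I s)) (scal (s' - s) 0))
          by (unfold minus, plus, opp, scal; simpl; unfold mult; simpl; ring).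
        apply is_RInt_ext with
          (fun t => minus (minus (fst (f (circle s' t))) (fst (f (circle s t))))
             (scal (s' - s) (fst (df (circle s t) * circle 1 t)%C))).
        - intros t _.
          rewrite (circle_scal s' t), (circle_scal s t).
          unfold minus, plus, opp, scal; simpl; unfold mult; simpl; ring.
        - apply (is_RInt_minus (V := R_NormedModule)).
          + apply (is_RInt_minus (V := R_NormedModule)); apply (RInt_correct (V := R_CompleteNormedModule)); apply Hex; lra.
          + apply (is_RInt_scal (V := R_NormedModule)).
            apply RInt_radial_derivative with f; [lra|].
            apply hol_subdisc with r; auto; lra. }
      rewrite <- (is_RInt_unique _ _ _ _ H1).
      eapply Rle_trans.
      - apply abs_RInt_le_const with (M := M * (s' - s) ^ 2).
        + assert (HP := PI_RGT_0); lra.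
        + exists (I s' - I s); exact H1.
        + intros t _. eapply Rle_trans; [apply fst_le_Cmod|].
          eapply Rle_trans; [apply Mr; apply circle_in_disc; lra|].
          rewrite (circle_scal s' t), (circle_scal s t).
          replace (RtoC s' * circle 1 t - RtoC s * circle 1 t)%C
            with (RtoC (s' - s) * circle 1 t)%C
            by (rewrite RtoC_minus; ring).
          rewrite Cmod_mult, Cmod_circle, Rmult_1_r, Cmod_R, pow2_abs by lra.
          lra.
      - lra. }
    apply constant_of_quadratic_modulus with (2 * PI * M); [lra|].
    intros s s' Hs Hs'.
    (* The linear term is known to vanish at positive radii only. The estimate is symmetric, so
       whichever radius is positive serves as base point. *)
    destruct (Rle_lt_dec s 0) as [Hz|Hz]; [|apply Hlt; lra].
    destruct (Rle_lt_dec s' 0) as [Hz'|Hz'].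
    - replace s' with s by lra.
      unfold Rminus; rewrite !Rplus_opp_r, Rabs_R0; lra.
    - rewrite Rabs_minus_sym; replace ((s' - s) ^ 2) with ((s - s') ^ 2) by ring.
      apply Hlt; lra. }
  rewrite <- HI0, <- HIr.
  apply (RInt_correct (V := R_CompleteNormedModule)), Hex; lra.
Qed.

(** Mean value property for [Cconj (f 0) * f]: its real part is |f 0|^2 at the centre and at most |f
    0| M on the circle. *)
Lemma maximum_principle (f df : C -> C) (M : R) :
  hol (closed_disc 1) f df ->
  (forall z, Cmod z = 1 -> Cmod (f z) <= M) -> Cmod (f 0%C) <= M.
Proof.
  intros H HM.
  destruct (Ceq_dec (f 0%C) 0%C) as [He|Hne].
  { rewrite He, Cmod_0. eapply Rle_trans; [apply Cmod_ge_0|].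
    apply (HM 1%C), Cmod_1. }
  assert (Hp : 0 < Cmod (f 0%C)) by (apply Cmod_gt_0; auto).
  set (u := (Cconj (f 0%C))).
  assert (Hu : hol (closed_disc 1) (fun z => u * f z)%C
                 (fun z => 0 * f z + u * df z)%C)
    by (apply hol_mult; [apply hol_const | exact H]).
  assert (H1 := mean_value_property 1 _ _ Rlt_0_1 Hu).
  assert (H2 : fst (u * f 0%C)%C = Cmod (f 0%C) ^ 2)
    by (rewrite Cmod_sq; unfold u; simpl; ring).
  assert (HP := PI_RGT_0).
  assert (H3 : 2 * PI * fst (u * f 0%C)%C <= (2 * PI - 0) * (Cmod (f 0%C) * M)).
  { eapply is_RInt_le; [| exact H1 | apply (is_RInt_const (V := R_NormedModule)) | ]; [lra|].
    intros t _. eapply Rle_trans; [apply Rle_abs|].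
    eapply Rle_trans; [apply fst_le_Cmod|].
    rewrite Cmod_mult; unfold u; rewrite Cmod_conj.
    apply Rmult_le_compat_l; [lra|]. apply HM, Cmod_circle; lra. }
  rewrite H2 in H3.
  apply Rmult_le_reg_l with (2 * PI * Cmod (f 0%C)); [|nra].
  apply Rmult_lt_0_compat; lra.
Qed.

(** * Power series *)

Lemma Csum_S (f : nat -> C) (n : nat) : Csum f (S n) = (Csum f n + f (S n))%C :> C.
Proof. reflexivity. Qed.

Lemma Csum_ext (f g : nat -> C) (n : nat) :
  (forall k, f k = g k) -> Csum f n = Csum g n.
Proof. intros H; induction n; simpl; rewrite ?IHn, ?H; reflexivity. Qed.

Lemma Csum_split_first (f : nat -> C) (n : nat) :
  Csum f (S n) = (f O + Csum (fun k => f (S k)) n)%C :> C.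
Proof.
  induction n as [|n IH]; [reflexivity|].
  rewrite Csum_S, IH, Csum_S; ring.
Qed.

Lemma Csum_scal (a : C) (f : nat -> C) (n : nat) :
  Csum (fun k => a * f k)%C n = (a * Csum f n)%C :> C.
Proof. induction n as [|n IH]; [reflexivity|]. rewrite !Csum_S, IH; ring. Qed.

Lemma Csum_plus (f g : nat -> C) (n : nat) :
  Csum (fun k => f k + g k)%C n = (Csum f n + Csum g n)%C :> C.
Proof. induction n as [|n IH]; [reflexivity|]. rewrite !Csum_S, IH; ring. Qed.

Lemma Cmod_Csum_le (f : nat -> C) (n : nat) :
  Cmod (Csum f n) <= sum_f_R0 (fun k => Cmod (f k)) n.
Proof.
  induction n as [|n IH]; [simpl; lra|].
  rewrite Csum_S; simpl; eapply Rle_trans; [apply Cmod_triangle|]; lra.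
Qed.

Lemma Csum_fst (f : nat -> C) (n : nat) :
  fst (Csum f n) = sum_f_R0 (fun k => fst (f k)) n.
Proof. induction n as [|n IH]; simpl; rewrite ?IH; reflexivity. Qed.

Lemma Csum_snd (f : nat -> C) (n : nat) :
  snd (Csum f n) = sum_f_R0 (fun k => snd (f k)) n.
Proof. induction n as [|n IH]; simpl; rewrite ?IH; reflexivity. Qed.

Lemma Cseq_cv_unique (u : nat -> C) (l l' : C) :
  Cseq_cv u l -> Cseq_cv u l' -> l = l'.
Proof.
  intros [H1 H2] [H1' H2']; destruct l, l'; simpl in *.
  f_equal; eapply UL_sequence; eauto.
Qed.

Lemma Un_cv_const (a : R) : Un_cv (fun _ => a) a.
Proof.
  intros eps He; exists O; intros; unfold Rdist, Rminus.
  rewrite Rplus_opp_r, Rabs_R0; auto.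
Qed.

Lemma Cseq_cv_const (a : C) : Cseq_cv (fun _ => a) a.
Proof. split; apply Un_cv_const. Qed.

Lemma Cseq_cv_plus (u v : nat -> C) (l m : C) :
  Cseq_cv u l -> Cseq_cv v m -> Cseq_cv (fun n => u n + v n)%C (l + m)%C.
Proof. intros [] []; split; simpl; apply CV_plus; auto. Qed.

Lemma Cseq_cv_mult (u v : nat -> C) (l m : C) :
  Cseq_cv u l -> Cseq_cv v m -> Cseq_cv (fun n => u n * v n)%C (l * m)%C.
Proof.
  intros [] []; split; simpl; [apply CV_minus | apply CV_plus];
    apply CV_mult; auto.
Qed.

Lemma Cseq_cv_ext (u v : nat -> C) (l : C) :
  (forall n, u n = v n) -> Cseq_cv u l -> Cseq_cv v l.
Proof.
  intros H [H1 H2]; split; [revert H1 | revert H2];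
    apply Un_cv_ext; intros; rewrite H; reflexivity.
Qed.

Lemma Cseq_cv_shift (u : nat -> C) (l : C) :
  Cseq_cv u l -> Cseq_cv (fun n => u (S n)) l.
Proof.
  intros [H1 H2]; split; intros eps He;
    [destruct (H1 eps He) as (N & HN) | destruct (H2 eps He) as (N & HN)];
    exists N; intros; apply HN; lia.
Qed.

Lemma Cseq_cv_le (u : nat -> C) (l : C) (M : R) :
  Cseq_cv u l -> (forall n, Cmod (u n) <= M) -> Cmod l <= M.
Proof.
  intros [H1 H2] H; apply le_epsilon; intros eps He.
  destruct (H1 (eps / 2)) as (N1 & HN1); [lra|].
  destruct (H2 (eps / 2)) as (N2 & HN2); [lra|].
  set (n := Nat.max N1 N2).
  specialize (HN1 n ltac:(lia)); specialize (HN2 n ltac:(lia)).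
  specialize (H n).
  replace l with (u n - (u n - l))%C by ring.
  eapply Rle_trans; [apply Cmod_triangle|]. rewrite Cmod_opp.
  assert (H3 := Cmod_le_add (u n - l)%C).
  unfold Rdist in *; simpl in *. unfold Rminus in *. lra.
Qed.

(** Radius of convergence at least 1, in a form that can be read off the terms of one convergent
    series per radius and that passes to shifted and differentiated coefficients. *)
Definition radius_one (c : nat -> C) : Prop :=
  forall r, 0 <= r < 1 -> exists M, forall k, Cmod (c k) * r ^ k <= M.

Lemma geometric_sum_le (q : R) (n : nat) :
  0 <= q < 1 -> sum_f_R0 (fun k => q ^ k) n <= / (1 - q).
Proof.
  intros Hq; rewrite tech3 by lra.
  assert (0 <= q ^ S n) by (apply pow_le; lra).
  unfold Rdiv; rewrite <- (Rmult_1_l (/ (1 - q))) at 2.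
  apply Rmult_le_compat_r; [|lra].
  apply Rlt_le, Rinv_0_lt_compat; lra.
Qed.

(** Every q^k with k <= n is at least q^n, so the geometric sum dominates n copies of q^n. The bound
    absorbs the factor k produced by differentiation. *)
Lemma nat_mul_pow_le (q : R) (n : nat) :
  0 <= q < 1 -> INR n * q ^ n <= / (1 - q).
Proof.
  intros Hq; eapply Rle_trans; [|apply geometric_sum_le with (n := n); auto].
  assert (H : forall m, (m <= n)%nat ->
            INR m * q ^ n <= sum_f_R0 (fun k => q ^ k) m).
  { induction m as [|m IH]; intros Hm; [simpl; lra|].
    rewrite S_INR, tech5.
    assert (q ^ n <= q ^ S m).
    { replace n with (S m + (n - S m))%nat by lia. rewrite pow_add.
      assert (0 <= q ^ S m) by (apply pow_le; lra).
      assert (q ^ (n - S m) <= 1 ^ (n - S m)) by (apply pow_incr; lra).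
      rewrite pow1 in *. nra. }
    specialize (IH ltac:(lia)); lra. }
  apply H; lia.
Qed.

Lemma radius_one_geometric (c : nat -> C) (r : R) :
  radius_one c -> 0 <= r < 1 ->
  exists M q, 0 <= M /\ 0 <= q < 1 /\
    forall k, Cmod (c k) * r ^ k <= M * q ^ k.
Proof.
  intros H Hr; set (s := (1 + r) / 2).
  assert (Hs : 0 < s < 1) by (unfold s; lra).
  destruct (H s) as (M & HM); [lra|].
  exists M, (r / s).
  assert (HM0 : 0 <= M).
  { eapply Rle_trans; [|apply (HM O)]. apply Rmult_le_pos; [apply Cmod_ge_0|].
    simpl; lra. }
  assert (Hq : 0 <= r / s < 1).
  { split; [apply Rmult_le_pos; [lra|apply Rlt_le, Rinv_0_lt_compat; lra]|].
    apply Rlt_div_l; unfold s; lra. }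
  repeat split; try lra.
  intros k; replace r with (s * (r / s)) at 1 by (field; lra).
  rewrite Rpow_mult_distr, <- Rmult_assoc.
  apply Rmult_le_compat_r; auto. apply pow_le; lra.
Qed.

Lemma radius_one_mul_nat (c : nat -> C) :
  radius_one c -> radius_one (fun k => RtoC (INR k) * c k)%C.
Proof.
  intros H r Hr; destruct (radius_one_geometric c r H Hr) as (M & q & HM & Hq & Hk).
  exists (M * / (1 - q)); intros k.
  rewrite Cmod_mult, Cmod_R, Rabs_right by (apply Rle_ge, pos_INR).
  assert (H1 := nat_mul_pow_le q k Hq); specialize (Hk k).
  assert (H2 := pos_INR k).
  assert (M * (INR k * q ^ k) <= M * / (1 - q))
    by (apply Rmult_le_compat_l; auto).
  assert (INR k * (Cmod (c k) * r ^ k) <= INR k * (M * q ^ k))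
    by (apply Rmult_le_compat_l; auto).
  lra.
Qed.

Lemma radius_one_shift (c : nat -> C) :
  radius_one c -> radius_one (fun k => c (S k)).
Proof.
  intros H r Hr.
  destruct (H ((1 + r) / 2)) as (M & HM); [lra|].
  (* The radius (1 + r) / 2 is at least 1/2, so removing one of its powers costs at most a factor
     2. *)
  exists (2 * M); intros k; specialize (HM (S k)); simpl in HM.
  assert (r ^ k <= ((1 + r) / 2) ^ k) by (apply pow_incr; lra).
  assert (Cmod (c (S k)) * r ^ k <= Cmod (c (S k)) * ((1 + r) / 2) ^ k)
    by (apply Rmult_le_compat_l; auto using Cmod_ge_0).
  assert (0 <= Cmod (c (S k)) * ((1 + r) / 2) ^ k)
    by (apply Rmult_le_pos; [apply Cmod_ge_0 | apply pow_le; lra]).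
  nra.
Qed.

Lemma radius_one_sum (c : nat -> C) (r : R) :
  radius_one c -> 0 <= r < 1 ->
  exists M, forall n, sum_f_R0 (fun k => Cmod (c k) * r ^ k) n <= M.
Proof.
  intros H Hr; destruct (radius_one_geometric c r H Hr) as (M & q & HM & Hq & Hk).
  exists (M * / (1 - q)); intros n.
  apply Rle_trans with (sum_f_R0 (fun k => q ^ k * M) n).
  { apply sum_Rle; intros k _; rewrite (Rmult_comm (q ^ k)); apply Hk. }
  rewrite <- scal_sum; apply Rmult_le_compat_l; auto.
  apply geometric_sum_le; auto.
Qed.

(** A total function obtained by choice; where the series diverges the value is arbitrary. *)
Definition ps (c : nat -> C) (z : C) : C :=
  epsilon (inhabits (RtoC 0)) (Cseq_cv (Csum (fun k => c k * z ^ k)%C)).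

Lemma ps_cv (c : nat -> C) (z : C) :
  radius_one c -> Cmod z < 1 ->
  Cseq_cv (Csum (fun k => c k * z ^ k)%C) (ps c z).
Proof.
  intros H Hz; unfold ps; apply epsilon_spec.
  destruct (radius_one_geometric c (Cmod z) H) as (M & q & HM & Hq & Hk).
  { split; [apply Cmod_ge_0 | auto]. }
  assert (Hg : ex_series (fun k => M * q ^ k)).
  { apply (ex_series_scal_l (K := R_AbsRing) (V := R_NormedModule) M (fun k => q ^ k)), ex_series_geom.
    rewrite Rabs_right; lra. }
  assert (Hb : forall k, Cmod (c k * z ^ k)%C <= M * q ^ k)
    by (intros k; rewrite Cmod_mult, Cmod_pow; apply Hk).
  destruct (ex_series_le (V := R_CompleteNormedModule)
              (fun k => fst (c k * z ^ k)%C) _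
              (fun k => Rle_trans _ _ _ (fst_le_Cmod _) (Hb k)) Hg) as (l1 & H1).
  destruct (ex_series_le (V := R_CompleteNormedModule)
              (fun k => snd (c k * z ^ k)%C) _
              (fun k => Rle_trans _ _ _ (snd_le_Cmod _) (Hb k)) Hg) as (l2 & H2).
  apply is_series_Reals in H1; apply is_series_Reals in H2.
  exists (l1, l2); split; simpl; [revert H1 | revert H2]; apply Un_cv_ext; intros n.
  - rewrite Csum_fst; reflexivity.
  - rewrite Csum_snd; reflexivity.
Qed.

Lemma ps_unique (c : nat -> C) (z l : C) :
  radius_one c -> Cmod z < 1 ->
  Cseq_cv (Csum (fun k => c k * z ^ k)%C) l -> ps c z = l.
Proof. intros; eapply Cseq_cv_unique; [apply ps_cv|]; eauto. Qed.

Lemma ps_unfold (c : nat -> C) (z : C) :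
  radius_one c -> Cmod z < 1 ->
  ps c z = (c O + z * ps (fun k => c (S k)) z)%C.
Proof.
  intros H Hz; apply Cseq_cv_unique
    with (fun n => c O + z * Csum (fun k => c (S k) * z ^ k) n)%C.
  - eapply Cseq_cv_ext; [|apply Cseq_cv_shift, (ps_cv c z H Hz)].
    intros n; cbv beta; rewrite Csum_split_first, <- Csum_scal; simpl.
    f_equal; [ring|]. apply Csum_ext; intros; ring.
  - apply Cseq_cv_plus; [apply Cseq_cv_const|].
    apply Cseq_cv_mult; [apply Cseq_cv_const|].
    apply ps_cv; auto. apply radius_one_shift; auto.
Qed.

(** The natural bound carries r^(k-1); the factor [r] on the left avoids a truncated exponent and a
    division. From k to k + 1 the error is multiplied by z + h and gains (k + 1) h^2 z^k. *)
Lemma pow_succ_remainder_le (z h : C) (r : R) (k : nat) :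
  Cmod z <= r -> Cmod (z + h)%C <= r ->
  Cmod ((z + h) ^ S k - z ^ S k - RtoC (INR (S k)) * h * z ^ k) * r
  <= INR (S k) ^ 2 * r ^ k * Cmod h ^ 2.
Proof.
  intros Hz Hh.
  assert (Hr : 0 <= r) by (eapply Rle_trans; [apply Cmod_ge_0 | apply Hz]).
  induction k as [|k IH].
  - simpl Cpow; simpl INR.
    replace ((z + h) * 1 - z * 1 - RtoC 1 * h * 1)%C with (RtoC 0) by ring.
    rewrite Cmod_0; assert (H := pow2_ge_0 (Cmod h)); simpl; nra.
  - replace ((z + h) ^ S (S k) - z ^ S (S k) - RtoC (INR (S (S k))) * h * z ^ S k)%C
      with ((z + h) * ((z + h) ^ S k - z ^ S k - RtoC (INR (S k)) * h * z ^ k)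
            + RtoC (INR (S k)) * (h * h) * z ^ k)%C
      by (rewrite (S_INR (S k)), RtoC_plus; simpl Cpow; ring).
    assert (Hn := pos_INR (S k)).
    assert (Hp : 0 <= r ^ k) by (apply pow_le; auto).
    assert (Hh2 := pow2_ge_0 (Cmod h)).
    eapply Rle_trans; [apply Rmult_le_compat_r, Cmod_triangle; auto|].
    rewrite Rmult_plus_distr_r, !Cmod_mult, Cmod_R, Cmod_pow,
      (Rabs_right (INR (S k))) by (apply Rle_ge; auto).
    assert (E1 : Cmod (z + h) * Cmod ((z + h) ^ S k - z ^ S k
                   - RtoC (INR (S k)) * h * z ^ k) * r
                 <= r * (INR (S k) ^ 2 * r ^ k * Cmod h ^ 2)).
    { rewrite Rmult_assoc; apply Rmult_le_compat; auto using Cmod_ge_0.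
      apply Rmult_le_pos; auto using Cmod_ge_0. }
    assert (E2 : INR (S k) * (Cmod h * Cmod h) * Cmod z ^ k * r
                 <= INR (S k) * (Cmod h * Cmod h) * r ^ k * r).
    { apply Rmult_le_compat_r; auto. apply Rmult_le_compat_l; [nra|].
      apply pow_incr; split; auto using Cmod_ge_0. }
    rewrite (S_INR (S k)). set (n := INR (S k)) in *.
    assert (0 <= r ^ k * r * Cmod h ^ 2) by (apply Rmult_le_pos; nra).
    simpl pow in *. nra.
Qed.

Definition deriv (c : nat -> C) (k : nat) : C := (RtoC (INR (S k)) * c (S k))%C.

Lemma radius_one_deriv (c : nat -> C) : radius_one c -> radius_one (deriv c).
Proof.
  intros H; exact (radius_one_shift _ (radius_one_mul_nat c H)).
Qed.

Lemma ps_bounded (c : nat -> C) (r : R) :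
  radius_one c -> 0 <= r < 1 ->
  exists M, forall z, Cmod z <= r -> Cmod (ps c z) <= M.
Proof.
  intros H Hr; destruct (radius_one_sum c r H Hr) as (M & HM).
  exists M; intros z Hz.
  eapply Cseq_cv_le; [apply ps_cv; auto; lra|].
  intros n; eapply Rle_trans; [apply Cmod_Csum_le|].
  eapply Rle_trans; [|apply (HM n)].
  apply sum_Rle; intros k _; rewrite Cmod_mult, Cmod_pow.
  apply Rmult_le_compat_l; [apply Cmod_ge_0|].
  apply pow_incr; split; auto using Cmod_ge_0.
Qed.

Lemma hol_ps (c : nat -> C) (r : R) :
  radius_one c -> 0 < r < 1 -> hol (closed_disc r) (ps c) (ps (deriv c)).
Proof.
  intros H Hr.
  assert (Hd := radius_one_deriv c H).
  destruct (ps_bounded c r H) as (M1 & HM1); [lra|].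
  destruct (ps_bounded _ r Hd) as (M2 & HM2); [lra|].
  (* Coefficients (k+1)^2 c_(k+1): by [pow_succ_remainder_le] the summed remainders are at most the
     sum of |e k| r^k, times |z' - z|^2 / r. *)
  set (e := fun k => (RtoC (INR (S k)) * (RtoC (INR (S k)) * c (S k)))%C).
  assert (He : radius_one e)
    by exact (radius_one_shift _ (radius_one_mul_nat _ (radius_one_mul_nat c H))).
  destruct (radius_one_sum e r He) as (M3 & HM3); [lra|].
  assert (HM3' : forall z z', closed_disc r z -> closed_disc r z' ->
    Cmod (ps c z' - ps c z - ps (deriv c) z * (z' - z))
      <= M3 * / r * Cmod (z' - z) ^ 2).
  { unfold closed_disc; intros z z' Hz Hz'.
    assert (Hc' := Cseq_cv_shift _ _ (ps_cv c z' H ltac:(lra))).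
    assert (Hc := Cseq_cv_shift _ _ (ps_cv c z H ltac:(lra))).
    assert (Hcd := ps_cv _ z Hd ltac:(lra)).
    apply Cseq_cv_le with
      (Csum (fun k => c (S k) * (z' ^ S k - z ^ S k
                      - RtoC (INR (S k)) * (z' - z) * z ^ k))%C).
    - apply Cseq_cv_ext with (fun n =>
        Csum (fun k => c k * z' ^ k) (S n) + (- (1)) * Csum (fun k => c k * z ^ k) (S n)
        + (- (1)) * (Csum (fun k => deriv c k * z ^ k) n * (z' - z)))%C.
      + intros n; rewrite !Csum_split_first.
        rewrite (Csum_ext (fun k => c (S k) * (z' ^ S k - z ^ S k
                      - RtoC (INR (S k)) * (z' - z) * z ^ k))%C
                  (fun k => c (S k) * z' ^ S k + (- (1) * (c (S k) * z ^ S k)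
                      + (- (1) * (z' - z)) * (deriv c k * z ^ k)))%C)
          by (intros k; unfold deriv; ring).
        rewrite Csum_plus, Csum_plus, !Csum_scal; simpl Cpow; ring.
      + replace (ps c z' - ps c z - ps (deriv c) z * (z' - z))%C
          with (ps c z' + - (1) * ps c z + - (1) * (ps (deriv c) z * (z' - z)))%C
          by ring.
        repeat first [apply Cseq_cv_plus | apply Cseq_cv_mult
                     | apply Cseq_cv_const]; auto.
    - intros n; eapply Rle_trans; [apply Cmod_Csum_le|].
      replace (M3 * / r * Cmod (z' - z) ^ 2)
        with (Cmod (z' - z) ^ 2 * / r * M3) by ring.
      apply Rle_trans with (Cmod (z' - z) ^ 2 * / r *
        sum_f_R0 (fun k => Cmod (e k) * r ^ k) n).
      + rewrite scal_sum; apply sum_Rle; intros k _.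
        assert (Hp := pow_succ_remainder_le z (z' - z) r k Hz).
        replace (z + (z' - z))%C with z' in Hp by ring.
        specialize (Hp Hz').
        unfold e; rewrite !Cmod_mult, !Cmod_R, !(Rabs_right (INR (S k)))
          by (apply Rle_ge, pos_INR).
        apply Rmult_le_reg_r with r; [lra|].
        replace (INR (S k) * (INR (S k) * Cmod (c (S k))) * r ^ k *
                 (Cmod (z' - z) ^ 2 * / r) * r)
          with (Cmod (c (S k)) * (INR (S k) ^ 2 * r ^ k * Cmod (z' - z) ^ 2))
          by (field; lra).
        rewrite Rmult_assoc. apply Rmult_le_compat_l; auto using Cmod_ge_0.
      + apply Rmult_le_compat_l; auto.
        apply Rmult_le_pos; [apply pow2_ge_0|].
        apply Rlt_le, Rinv_0_lt_compat; lra. }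
  apply hol_intro with (Rabs M1 + Rabs M2 + Rabs (M3 * / r));
    assert (P1 := Rabs_pos M1); assert (P2 := Rabs_pos M2);
    assert (P3 := Rabs_pos (M3 * / r)).
  - intros z Hz; specialize (HM1 z Hz); assert (H1 := Rle_abs M1); lra.
  - intros z Hz; specialize (HM2 z Hz); assert (H1 := Rle_abs M2); lra.
  - intros z z' Hz Hz'; eapply Rle_trans; [apply HM3'; auto|].
    apply Rmult_le_compat_r; [apply pow2_ge_0|].
    assert (H1 := Rle_abs (M3 * / r)); lra.
Qed.

(** * The Schwarz-Pick lemma *)

Lemma hol_scal (D : C -> Prop) (a : C) (f df : C -> C) :
  hol D f df -> hol D (fun z => a * f z)%C (fun z => 0 * f z + a * df z)%C.
Proof. intros H; apply hol_mult; [apply hol_const | exact H]. Qed.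

Lemma hol_disc_id (r : R) : hol (closed_disc r) (fun z => z) (fun _ => RtoC 1).
Proof. apply hol_id with r; auto. Qed.

Lemma blaschke_identity_real (a : R) (z : C) :
  Cmod (1 - a * z) ^ 2 - Cmod (z - a) ^ 2 = (1 - a ^ 2) * (1 - Cmod z ^ 2).
Proof. rewrite !Cmod_sq; simpl; ring. Qed.

Lemma Cmod_one_sub_ge (z : C) : 1 - Cmod z <= Cmod (1 - z).
Proof.
  assert (H := Cmod_triangle (1 - z) z).
  replace (1 - z + z)%C with (RtoC 1) in H by ring. rewrite Cmod_1 in H; lra.
Qed.

Lemma Cmod_one_sub_le (z : C) : Cmod (1 - z) <= 1 + Cmod z.
Proof.
  eapply Rle_trans; [apply Cmod_triangle|]. rewrite Cmod_opp, Cmod_1; lra.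
Qed.

Lemma Cmod_pos_neq (z : C) : 0 < Cmod z -> z <> 0%C.
Proof. apply Cmod_gt_0. Qed.

(** Divide the Blaschke factor at [xi] of [g w] by that of [w]. On the unit circle the denominator
    is unimodular and the numerator has modulus at most 1, so the maximum principle bounds the
    quotient at [w0]. The factorisation through [g1] stands in for the removable singularity at
    [xi]. *)
Lemma schwarz_pick_fixed_point (g dg g1 dg1 : C -> C) (xi : R) (w0 : C) :
  0 < xi < 1 ->
  hol (closed_disc 1) g dg -> hol (closed_disc 1) g1 dg1 ->
  (forall w, Cmod w <= 1 -> Cmod (g w) <= 1) ->
  (forall w, Cmod w <= 1 -> g w - xi = (w - xi) * g1 w)%C ->
  Cmod w0 < 1 ->
  Cmod (g w0 - xi) * Cmod (1 - xi * w0)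
  <= Cmod (w0 - xi) * Cmod (1 - xi * g w0).
Proof.
  intros Hxi Hg Hg1 Hb Hf Hw0.
  (* Disc automorphism with [m 0 = w0], because [maximum_principle] speaks of the centre only. *)
  set (m := fun t => ((t + w0) * / (1 + Cconj w0 * t))%C).
  assert (Hden : forall t, Cmod t <= 1 -> 1 - Cmod w0 <= Cmod (1 + Cconj w0 * t)).
  { intros t Ht; assert (H := Cmod_one_sub_ge (- (Cconj w0 * t))%C).
    replace (1 - - (Cconj w0 * t))%C with (1 + Cconj w0 * t)%C in H by ring.
    rewrite Cmod_opp, Cmod_mult, Cmod_conj in H.
    assert (H1 := Cmod_ge_0 w0); assert (H2 := Cmod_ge_0 t); nra. }
  assert (Hden0 : forall t, Cmod t <= 1 -> (1 + Cconj w0 * t)%C <> 0%C).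
  { intros t Ht; apply Cmod_pos_neq; specialize (Hden t Ht); lra. }
  assert (Hm : exists dm, hol (closed_disc 1) m dm).
  { eexists; unfold m; apply hol_mult.
    - apply hol_plus; [apply hol_disc_id | apply hol_const].
    - apply hol_inv with (1 - Cmod w0); [lra | exact Hden |].
      apply hol_plus; [apply hol_const | apply hol_scal, hol_disc_id]. }
  destruct Hm as [dm Hm].
  assert (Hmod : forall t, Cmod t <= 1 ->
     Cmod (m t) ^ 2 * Cmod (1 + Cconj w0 * t) ^ 2
     = Cmod (1 + Cconj w0 * t) ^ 2 - (1 - Cmod w0 ^ 2) * (1 - Cmod t ^ 2)).
  { intros t Ht; rewrite <- Rpow_mult_distr, <- Cmod_mult; unfold m.
    replace ((t + w0) * / (1 + Cconj w0 * t) * (1 + Cconj w0 * t))%C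
      with (t + w0)%C by (field; auto).
    rewrite !Cmod_sq; simpl; ring. }
  assert (Hw0sq : 0 < 1 - Cmod w0 ^ 2)
    by (assert (H := Cmod_ge_0 w0); nra).
  assert (Hm1 : forall t, Cmod t <= 1 -> Cmod (m t) <= 1).
  { intros t Ht; specialize (Hmod t Ht); specialize (Hden t Ht).
    assert (Ht2 : 0 <= 1 - Cmod t ^ 2) by (assert (H := Cmod_ge_0 t); nra).
    assert (Hq : 0 <= (1 - Cmod w0 ^ 2) * (1 - Cmod t ^ 2)) by nra.
    assert (Hp : 0 < Cmod (1 + Cconj w0 * t) ^ 2) by (apply pow_lt; lra).
    apply Rsqr_incr_0_var; [|lra]. rewrite !Rsqr_pow2, pow1.
    apply Rmult_le_reg_r with (Cmod (1 + Cconj w0 * t) ^ 2); lra. }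
  assert (Hm2 : forall t, Cmod t = 1 -> Cmod (m t) = 1).
  { intros t Ht; assert (Ht' : Cmod t <= 1) by lra.
    specialize (Hmod t Ht'); specialize (Hden t Ht').
    rewrite Ht in Hmod. assert (H := Cmod_ge_0 (m t)).
    assert (Hp : 0 < Cmod (1 + Cconj w0 * t) ^ 2) by (apply pow_lt; lra).
    assert (Cmod (m t) ^ 2 = 1).
    { apply Rmult_eq_reg_r with (Cmod (1 + Cconj w0 * t) ^ 2); lra. }
    nra. }
  assert (Hgden : forall w, Cmod w <= 1 -> 1 - xi <= Cmod (1 - xi * g w)).
  { intros w Hw; assert (H := Cmod_one_sub_ge (xi * g w)%C).
    rewrite Cmod_mult, Cmod_R, Rabs_right in H by lra.
    specialize (Hb w Hw); nra. }
  (* The quotient of the two Blaschke factors, with the common zero [w - xi] already cancelled. *)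
  set (h := fun w => (g1 w * (1 + - xi * w) * / (1 + - xi * g w))%C).
  assert (Hh : exists dh, hol (closed_disc 1) h dh).
  { eexists; unfold h; apply hol_mult; [apply hol_mult; [exact Hg1|]|].
    - apply hol_plus; [apply hol_const | apply hol_scal, hol_disc_id].
    - apply hol_inv with (1 - xi); [lra | |].
      + intros w Hw; replace (1 + - xi * g w)%C with (1 - xi * g w)%C by ring.
        apply Hgden; auto.
      + apply hol_plus; [apply hol_const | apply hol_scal; exact Hg]. }
  destruct Hh as [dh Hh].
  assert (Hmax : Cmod (h (m 0%C)) <= 1).
  { apply (maximum_principle (fun t => h (m t)) _ 1
             (hol_comp _ _ _ _ _ _ Hm1 Hh Hm)).
    intros t Ht; specialize (Hm2 t Ht); set (w := m t) in *.
    assert (Hw : Cmod w <= 1) by lra.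
    assert (H1 : Cmod (1 - xi * w) = Cmod (w - xi)).
    { assert (H := blaschke_identity_real xi w). rewrite Hm2 in H.
      assert (Ha := Cmod_ge_0 (1 - xi * w)); assert (Hb' := Cmod_ge_0 (w - xi)).
      nra. }
    assert (H2 : Cmod (g w - xi) <= Cmod (1 - xi * g w)).
    { apply Cmod_le_sq; assert (H := blaschke_identity_real xi (g w)).
      specialize (Hb w Hw). assert (H0 := Cmod_ge_0 (g w)).
      assert (0 <= 1 - Cmod (g w) ^ 2) by nra.
      assert (0 <= (1 - xi ^ 2) * (1 - Cmod (g w) ^ 2))
        by (apply Rmult_le_pos; nra).
      lra. }
    specialize (Hgden w Hw).
    unfold h; replace (1 + - xi * g w)%C with (1 - xi * g w)%C by ring.
    replace (1 + - xi * w)%C with (1 - xi * w)%C by ring.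
    rewrite !Cmod_mult, Cmod_inv, H1 by (apply Cmod_pos_neq; lra).
    rewrite <- Cmod_mult, Cmult_comm, <- Hf by auto.
    apply Rmult_le_reg_r with (Cmod (1 - xi * g w)); [lra|].
    rewrite Rmult_assoc, Rinv_l by lra. lra. }
  assert (E : m 0%C = w0).
  { unfold m; replace (1 + Cconj w0 * 0)%C with (RtoC 1) by ring.
    field; apply C1_nz. }
  rewrite E in Hmax.
  assert (Hw0' : Cmod w0 <= 1) by lra.
  rewrite (Hf w0 Hw0'), Cmod_mult.
  specialize (Hgden w0 Hw0').
  unfold h in Hmax; replace (1 + - xi * g w0)%C with (1 - xi * g w0)%C in Hmax by ring.
  replace (1 + - xi * w0)%C with (1 - xi * w0)%C in Hmax by ring.
  rewrite !Cmod_mult, Cmod_inv in Hmax by (apply Cmod_pos_neq; lra).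
  rewrite Rmult_assoc; apply Rmult_le_compat_l; [apply Cmod_ge_0|].
  apply Rmult_le_compat_r with (r := Cmod (1 - xi * g w0)) in Hmax; [|lra].
  rewrite Rmult_assoc, Rinv_l in Hmax by lra. lra.
Qed.

(** [c] holds the coefficients of F', so that the growth condition bears on [ps c] itself. *)
Definition bloch (c : nat -> C) : Prop :=
  radius_one c /\
  forall z, Cmod z < 1 -> Cmod (ps c z) <= 1 / (1 - Cmod z ^ 2).

Lemma RtoC_pow (a : R) (n : nat) : RtoC (a ^ n) = (RtoC a ^ n)%C.
Proof. induction n as [|n IH]; simpl; [|rewrite RtoC_mult, IH]; reflexivity. Qed.

Lemma Cmod_mul_real (a : R) (z : C) : 0 <= a -> Cmod (a * z) = a * Cmod z.
Proof. intros; rewrite Cmod_mult, Cmod_R, Rabs_right; lra. Qed.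

(** This is how the admissible radii enter: the hypothesis on [r] rearranges to w < 1 at z = r, the
    point of |z| <= r where |w| is largest. *)
Lemma radius_pos (s x r : R) :
  s ^ 2 = 3 -> 0 < s -> 0 < x -> s * x < 1 -> r * (s - x) < 1 - s * x ->
  0 <= r -> r < 1 /\ s * (r + x) < 1 + x * r.
Proof.
  intros Hs Hs0 Hx Hsx Hr Hr0.
  assert (1 < s) by nra. assert (x < 1) by nra. split; nra.
Qed.

Lemma Cmod_mobius_lt_one (s x : R) (z : C) :
  s ^ 2 = 3 -> 0 < s -> 0 < x -> s * x < 1 ->
  Cmod z * (s - x) < 1 - s * x ->
  Cmod (1 + x * z) <> 0 /\ Cmod (s * (z + x) / (1 + x * z)) < 1.
Proof.
  intros Hs Hs0 Hx Hsx Hz; assert (Hr0 := Cmod_ge_0 z).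
  destruct (radius_pos s x (Cmod z)) as [H1 H2]; auto.
  assert (Hx1 : x < 1) by nra.
  assert (Hden : 1 - x * Cmod z <= Cmod (1 + x * z)).
  { assert (H := Cmod_one_sub_ge (- (x * z))%C).
    replace (1 - - (x * z))%C with (1 + x * z)%C in H by ring.
    rewrite Cmod_opp, Cmod_mul_real in H by lra. exact H. }
  assert (Hpos : 0 < Cmod (1 + x * z)) by nra.
  split; [lra|].
  rewrite Cmod_div by (apply Cmod_pos_neq; auto).
  apply Rlt_div_l; auto. rewrite Rmult_1_l, Cmod_mul_real by lra.
  apply Rsqr_incrst_0; [| apply Rmult_le_pos; [lra|apply Cmod_ge_0] | lra].
  rewrite !Rsqr_pow2, Rpow_mult_distr, !Cmod_sq, Hs; simpl fst; simpl snd.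
  assert (Hre : fst z <= Cmod z)
    by (eapply Rle_trans; [apply Rle_abs | apply fst_le_Cmod]).
  assert (Hsq := Cmod_sq z). set (r := Cmod z) in *.
  assert (Hk : 3 * (r + x) ^ 2 < (1 + x * r) ^ 2).
  { rewrite <- Hs, <- Rpow_mult_distr. apply Rsqr_incrst_1 in H2; [|nra|nra].
    rewrite !Rsqr_pow2 in H2; exact H2. }
  nra.
Qed.

(* In the coordinate [w = sqrt 3 (z + x) / (1 + x z)] the normalised derivative
   maps the unit disc to itself and fixes [sqrt 3 x]. *)
Lemma bloch_schwarz_pick (c : nat -> C) (s x : R) (z0 : C) :
  s ^ 2 = 3 -> 0 < s -> 0 < x -> s * x < 1 ->
  bloch c -> c O = RtoC (3 * s / 2 * x * (1 - x ^ 2)) ->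
  Cmod z0 * (s - x) < 1 - s * x ->
  let w0 := (s * (z0 + x) / (1 + x * z0))%C in
  let f0 := (RtoC (2 / (3 * (1 - x ^ 2))) * (1 + x * z0) ^ 2 * ps c z0)%C in
  Cmod (f0 - RtoC (s * x)) * Cmod (1 - RtoC (s * x) * w0)
  <= Cmod (w0 - RtoC (s * x)) * Cmod (1 - RtoC (s * x) * f0).
Proof.
  intros Hs Hs0 Hx Hsx [Hc Hbl] Hc0 Hz0 w0 f0.
  destruct (Cmod_mobius_lt_one s x z0) as [Hden0 Hw0]; auto.
  assert (Hden0' : (1 + x * z0)%C <> 0%C)
    by (intros E; apply Hden0; rewrite E; apply Cmod_0).
  assert (Hs1 : 1 < s) by nra. assert (Hx1 : x < 1) by nra.
  assert (Hq : 0 < 1 - x ^ 2) by nra.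
  assert (Hk : 0 < 2 / (3 * (1 - x ^ 2))) by (apply Rdiv_lt_0_compat; lra).
  set (k := 2 / (3 * (1 - x ^ 2))) in *.
  (* Inverse of the change of coordinate z -> s (z + x) / (1 + x z); the argument takes place on |w|
     <= 1. *)
  set (Z := fun w : C => ((w + RtoC (- (s * x))) * / (s + RtoC (- x) * w))%C).
  assert (Hd : forall w, Cmod w <= 1 -> s - x <= Cmod (s + RtoC (- x) * w)).
  { intros w Hw.
    assert (H := Cmod_triangle (s + RtoC (- x) * w) (x * w)).
    replace (s + RtoC (- x) * w + x * w)%C with (RtoC s) in H
      by (rewrite RtoC_opp; ring).
    rewrite Cmod_R, Rabs_right, Cmod_mul_real in H by lra.
    assert (0 <= Cmod w) by apply Cmod_ge_0. nra. }
  assert (Hsx0 : 0 < s - x) by lra.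
  assert (Hd' : forall w, Cmod w <= 1 -> Cmod (s + RtoC (- x) * w) <= s + x).
  { intros w Hw; eapply Rle_trans; [apply Cmod_triangle|].
    rewrite Cmod_mult, !Cmod_R, Rabs_Ropp, !Rabs_right by lra. nra. }
  assert (Hdn : forall w, Cmod w <= 1 -> (s + RtoC (- x) * w)%C <> 0%C)
    by (intros w Hw; apply Cmod_pos_neq; specialize (Hd w Hw); lra).
  assert (HZ : exists dZ, hol (closed_disc 1) Z dZ).
  { eexists; unfold Z; apply hol_mult.
    - apply hol_plus; [apply hol_disc_id | apply hol_const].
    - apply hol_inv with (s - x); [lra | exact Hd |].
      apply hol_plus; [apply hol_const | apply hol_scal, hol_disc_id]. }
  destruct HZ as [dZ HZ].
  assert (HZid : forall w, Cmod w <= 1 ->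
            (1 - Cmod (Z w) ^ 2) * Cmod (s + RtoC (- x) * w) ^ 2
            = (3 - Cmod w ^ 2) * (1 - x ^ 2)).
  { intros w Hw; rewrite Rmult_minus_distr_r, <- Rpow_mult_distr, <- Cmod_mult.
    unfold Z.
    replace ((w + RtoC (- (s * x))) * / (s + RtoC (- x) * w)
             * (s + RtoC (- x) * w))%C
      with (w + RtoC (- (s * x)))%C by (field; auto).
    rewrite !Cmod_sq; simpl. rewrite <- Hs. ring. }
  (* By [HZid], with 3 - |w|^2 >= 2 and |s - x w| <= s + x, the closed unit disc is carried by [Z]
     into a closed disc of radius [R0 < 1], where [hol_ps] applies. *)
  set (R0 := sqrt (1 - 2 * (1 - x ^ 2) / (s + x) ^ 2)).
  assert (HR1 : 0 < 2 * (1 - x ^ 2) / (s + x) ^ 2 < 1).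
  { assert (0 < (s + x) ^ 2) by nra. split; [apply Rdiv_lt_0_compat; lra|].
    apply Rlt_div_l; nra. }
  assert (HR : 0 < R0 < 1).
  { unfold R0; split; [apply sqrt_lt_R0; lra|].
    eapply Rlt_le_trans; [apply sqrt_lt_1_alt with (y := 1); lra|].
    rewrite sqrt_1; lra. }
  assert (HZR : forall w, closed_disc 1 w -> closed_disc R0 (Z w)).
  { unfold closed_disc; intros w Hw; specialize (HZid w Hw).
    specialize (Hd' w Hw); specialize (Hd w Hw).
    unfold R0; rewrite <- (sqrt_pow2 (Cmod (Z w))) by apply Cmod_ge_0.
    apply sqrt_le_1_alt.
    assert (Hw2 : Cmod w ^ 2 <= 1) by (assert (H := Cmod_ge_0 w); nra).
    set (d := Cmod (s + RtoC (- x) * w)) in *.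
    assert (Hdd : d ^ 2 <= (s + x) ^ 2) by (apply pow_incr; lra).
    assert (Hd0 : 0 < d ^ 2) by (apply pow_lt; lra).
    assert (H1 : 2 * (1 - x ^ 2) <= (1 - Cmod (Z w) ^ 2) * (s + x) ^ 2).
    { assert (0 <= 1 - Cmod (Z w) ^ 2).
      { apply Rmult_le_reg_r with (d ^ 2); auto. rewrite HZid. nra. }
      nra. }
    apply Rle_div_l in H1; [lra|]. nra. }
  assert (HZ1 : forall w, Cmod w <= 1 -> Cmod (Z w) < 1)
    by (intros w Hw; assert (H := HZR w Hw); unfold closed_disc in H; lra).
  assert (Hc' := radius_one_shift c Hc).
  set (c' := fun k => c (S k)) in *.
  set (g := fun w => (k * ((1 + x * Z w) * (1 + x * Z w) * ps c (Z w)))%C).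
  set (a := RtoC (3 * s / 2 * x * (1 - x ^ 2))) in *.
  (* Since [k * a = s * x], subtracting s x from [g w] cancels the constant term in [Z w]. A factor
     [Z w] comes out of the rest, and it equals (w - s x) / (s - x w). *)
  set (g1 := fun w => (k * ((RtoC (2 * x) * a + RtoC (x ^ 2) * a * Z w
                + (1 + x * Z w) * (1 + x * Z w) * ps c' (Z w))
                * / (s + RtoC (- x) * w)))%C).
  assert (Hpsc : exists d, hol (closed_disc 1) (fun w => ps c (Z w)) d)
    by (eexists; apply (hol_comp _ (closed_disc R0));
        [exact HZR | apply hol_ps; auto | exact HZ]).
  assert (Hpsc' : exists d, hol (closed_disc 1) (fun w => ps c' (Z w)) d)
    by (eexists; apply (hol_comp _ (closed_disc R0));
        [exact HZR | apply hol_ps; auto | exact HZ]).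
  destruct Hpsc as [d1 Hd1], Hpsc' as [d2 Hd2].
  assert (Hlin : exists d, hol (closed_disc 1) (fun w => 1 + x * Z w)%C d)
    by (eexists; apply hol_plus; [apply hol_const | apply hol_scal; exact HZ]).
  destruct Hlin as [d3 Hd3].
  assert (Hg : exists dg, hol (closed_disc 1) g dg).
  { eexists; unfold g; apply hol_scal, hol_mult; [apply hol_mult; exact Hd3|].
    exact Hd1. }
  assert (Hg1 : exists dg, hol (closed_disc 1) g1 dg).
  { eexists; unfold g1; apply hol_scal, hol_mult.
    - apply hol_plus; [apply hol_plus; [apply hol_const|apply hol_scal; exact HZ]|].
      apply hol_mult; [apply hol_mult; exact Hd3 | exact Hd2].
    - apply hol_inv with (s - x); [lra | exact Hd |].
      apply hol_plus; [apply hol_const | apply hol_scal, hol_disc_id]. }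
  destruct Hg as [dg Hg], Hg1 as [dg1 Hg1].
  (* Here 1 + x Z = s (1 - x^2) / (s - x w). Inserted in the growth bound together with [HZid],
     everything cancels except 2 / (3 - |w|^2). *)
  assert (Hgb : forall w, Cmod w <= 1 -> Cmod (g w) <= 1).
  { intros w Hw. specialize (HZid w Hw); specialize (HZ1 w Hw).
    specialize (Hd w Hw); specialize (Hbl _ HZ1).
    assert (E : (1 + x * Z w)%C
                = (RtoC (s * (1 - x ^ 2)) * / (s + RtoC (- x) * w))%C).
    { unfold Z. rewrite !RtoC_mult, RtoC_minus, !RtoC_opp, RtoC_pow, RtoC_mult.
      specialize (Hdn w Hw). rewrite RtoC_opp in Hdn. field; auto. }
    unfold g; rewrite Cmod_mul_real, !Cmod_mult, E, Cmod_mul_real, Cmod_inv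
      by (auto; nra).
    set (d := Cmod (s + RtoC (- x) * w)) in *.
    assert (Hd0 : 0 < d) by lra.
    assert (Hw2 : Cmod w ^ 2 <= 1) by (assert (H := Cmod_ge_0 w); nra).
    assert (HZ2 : 0 < 1 - Cmod (Z w) ^ 2)
      by (assert (H := Cmod_ge_0 (Z w)); nra).
    replace (k * (s * (1 - x ^ 2) * / d * (s * (1 - x ^ 2) * / d)
                  * Cmod (ps c (Z w))))
      with (2 * (1 - x ^ 2) * / d ^ 2 * Cmod (ps c (Z w))).
    2:{ transitivity (2 * (1 - x ^ 2) * (s ^ 2 / 3) / d ^ 2 * Cmod (ps c (Z w))).
        - rewrite Hs; field; lra.
        - unfold k; field; lra. }
    apply Rle_trans with (2 * (1 - x ^ 2) * / d ^ 2 * (1 / (1 - Cmod (Z w) ^ 2))).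
    { apply Rmult_le_compat_l; auto.
      apply Rmult_le_pos; [lra|]. apply Rlt_le, Rinv_0_lt_compat, pow_lt; auto. }
    replace (2 * (1 - x ^ 2) * / d ^ 2 * (1 / (1 - Cmod (Z w) ^ 2)))
      with (2 * (1 - x ^ 2) / ((1 - Cmod (Z w) ^ 2) * d ^ 2)) by (field; lra).
    rewrite HZid. apply Rle_div_l; nra. }
  assert (Hfac : forall w, Cmod w <= 1 ->
            (g w - RtoC (s * x) = (w - RtoC (s * x)) * g1 w)%C).
  { intros w Hw. specialize (HZ1 w Hw).
    unfold g, g1. rewrite (ps_unfold c (Z w) Hc HZ1). fold c'. rewrite Hc0.
    assert (E : (w - RtoC (s * x))%C = (Z w * (s + RtoC (- x) * w))%C).
    { unfold Z. rewrite !RtoC_opp, RtoC_mult.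
      specialize (Hdn w Hw). rewrite RtoC_opp in Hdn. field; auto. }
    rewrite E.
    assert (Eka : (k * a)%C = RtoC (s * x)).
    { unfold a, k; rewrite <- RtoC_mult; f_equal; field; lra. }
    rewrite <- Eka, RtoC_mult, RtoC_pow.
    specialize (Hdn w Hw). field; auto. }
  assert (Hxi : 0 < s * x < 1) by (split; [nra | auto]).
  assert (EZ : Z w0 = z0).
  { unfold Z, w0.
    assert (RtoC s <> 0%C) by (apply Cmod_pos_neq; rewrite Cmod_R, Rabs_right; lra).
    assert (RtoC (1 - x ^ 2) <> 0%C)
      by (apply Cmod_pos_neq; rewrite Cmod_R, Rabs_right; lra).
    rewrite RtoC_minus, RtoC_pow in *.
    rewrite !RtoC_opp, RtoC_mult. field; split; auto.
    match goal with |- ?e <> _ =>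
      replace e with (s * (1 - x ^ 2))%C by ring end.
    apply Cmult_neq_0; auto. }
  assert (H := schwarz_pick_fixed_point g dg g1 dg1 (s * x) w0 Hxi Hg Hg1
                 Hgb Hfac Hw0).
  replace f0 with (g w0); auto.
  unfold g, f0; rewrite EZ; ring.
Qed.

(** * Subordination to the extremal function *)

Lemma hol_ext_deriv (D : C -> Prop) (f g df dg : C -> C) :
  (forall z, D z -> f z = g z) -> (forall z, D z -> df z = dg z) ->
  hol D f df -> hol D g dg.
Proof.
  intros He Hd [M H]; exists M; intros z Hz.
  destruct (H z Hz) as (H1 & H2 & H3).
  rewrite <- (He z Hz), <- (Hd z Hz); repeat split; auto.
  intros z' Hz'; rewrite <- (He z' Hz'); auto.
Qed.

(** * Minimisation over a closed disc *)

Lemma polar_form (z : C) : exists t, 0 <= t <= 2 * PI /\ z = circle (Cmod z) t.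
Proof.
  assert (HP := PI_RGT_0).
  destruct (Req_dec (Cmod z) 0) as [He|Hne].
  { exists 0; split; [lra|]. rewrite He; unfold circle; rewrite !Rmult_0_l.
    apply Cmod_eq_0; exact He. }
  assert (H0 := Cmod_ge_0 z). assert (Hp : 0 < Cmod z) by lra.
  destruct z as [a b]; set (m := Cmod (a, b)) in *.
  assert (Hm : m ^ 2 = a ^ 2 + b ^ 2) by apply (Cmod_sq (a, b)).
  assert (Ha : -1 <= a / m <= 1).
  { split; [apply Rle_div_r | apply Rle_div_l]; nra. }
  assert (Hs : sqrt (1 - Rsqr (a / m)) = Rabs b / m).
  { replace (1 - Rsqr (a / m)) with (Rsqr (b / m)).
    - rewrite sqrt_Rsqr_abs; unfold Rdiv; rewrite Rabs_mult, Rabs_inv.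
      rewrite (Rabs_right m); lra.
    - unfold Rsqr; field_simplify_eq; [lra|lra]. }
  destruct (acos_bound (a / m)) as [A1 A2].
  destruct (Rle_lt_dec 0 b) as [Hb|Hb].
  - exists (acos (a / m)); split; [lra|]. unfold circle.
    rewrite cos_acos, sin_acos, Hs, Rabs_right by lra. f_equal; field; lra.
  - exists (2 * PI - acos (a / m)); split; [lra|]. unfold circle.
    replace (2 * PI - acos (a / m)) with (- acos (a / m) + 2 * INR 1 * PI)
      by (simpl; ring).
    rewrite cos_period, sin_period, cos_neg, sin_neg, cos_acos, sin_acos, Hs,
      Rabs_left by lra.
    f_equal; field; lra.
Qed.

(** Compactness through two uses of the one-variable extreme value theorem in polar coordinates. The
    minimising angle [th t] may jump with the radius, but the minimal value on the circle of radius
    t is Lipschitz in t ([Hone]). *)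
Lemma disc_minimum (g : C -> R) (r L : R) :
  0 <= r -> 0 <= L ->
  (forall z z', closed_disc r z -> closed_disc r z' ->
     Rabs (g z' - g z) <= L * Cmod (z' - z)) ->
  exists z0, closed_disc r z0 /\ forall z, closed_disc r z -> g z0 <= g z.
Proof.
  intros Hr HL HLip; assert (HP := PI_RGT_0).
  assert (Hin : forall t th, 0 <= t <= r -> closed_disc r (circle t th))
    by (intros; apply circle_in_disc; lra).
  assert (Hth : forall t, exists th, 0 <= t <= r ->
            forall th', 0 <= th' <= 2 * PI ->
            g (circle t th) <= g (circle t th')).
  { intros t; destruct (Rle_lt_dec 0 t) as [H0|H0]; [|exists 0; intros; lra].
    destruct (Rle_lt_dec t r) as [H1|H1]; [|exists 0; intros; lra].
    destruct (continuity_ab_min (fun th => g (circle t th)) 0 (2 * PI))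
      as (th & Hth & _); [lra| |exists th; auto].
    intros th _; apply continuity_pt_filterlim.
    apply continuous_of_lipschitz with (L * (4 * t)); intros th'.
    eapply Rle_trans; [apply HLip; apply Hin; lra|].
    rewrite Rmult_assoc; apply Rmult_le_compat_l; auto.
    apply circle_lipschitz; auto. }
  set (th := fun t => epsilon (inhabits 0) (fun th => 0 <= t <= r ->
               forall th', 0 <= th' <= 2 * PI ->
               g (circle t th) <= g (circle t th'))).
  assert (Hmin : forall t, 0 <= t <= r -> forall z, Cmod z = t ->
            g (circle t (th t)) <= g z).
  { intros t Ht z Hz; destruct (polar_form z) as (u & Hu & Ez).
    rewrite Ez, Hz; revert u Hu Ez; intros u Hu _; revert u Hu.
    exact (epsilon_spec (inhabits 0) _ (Hth t) Ht). }
  (* [continuous_of_lipschitz] asks for a bound on the whole line, so the radius is clamped to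
     [0, r]. *)
  set (clamp := fun t => Rmax 0 (Rmin t r)).
  assert (Hclamp : forall t, 0 <= clamp t <= r).
  { intros t; unfold clamp; split; [apply Rmax_l|].
    apply Rmax_lub; [lra | apply Rmin_r]. }
  assert (Hclamp1 : forall t t', Rabs (clamp t' - clamp t) <= Rabs (t' - t)).
  { intros t t'; unfold clamp, Rmax, Rmin, Rabs.
    destruct (Rle_dec t r), (Rle_dec t' r), (Rcase_abs (t' - t));
      repeat match goal with |- context [Rle_dec ?a ?b] => destruct (Rle_dec a b) end;
      match goal with |- context [Rcase_abs ?a] => destruct (Rcase_abs a) end; lra. }
  assert (Hone : forall t t', 0 <= t <= r -> 0 <= t' <= r ->
            g (circle t' (th t')) <= g (circle t (th t)) + L * Rabs (t' - t)).
  { intros t t' Ht Ht'.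
    apply Rle_trans with (g (circle t' (th t))).
    { apply Hmin; auto. apply Cmod_circle; lra. }
    assert (H := HLip (circle t (th t)) (circle t' (th t))
                   (Hin _ _ Ht) (Hin _ _ Ht')).
    rewrite (circle_scal t'), (circle_scal t) in H.
    replace (RtoC t' * circle 1 (th t) - RtoC t * circle 1 (th t))%C
      with (RtoC (t' - t) * circle 1 (th t))%C in H
      by (rewrite RtoC_minus; ring).
    rewrite Cmod_mult, Cmod_circle, Rmult_1_r, Cmod_R, <- !circle_scal in H by lra.
    assert (H1 := Rle_abs (g (circle t' (th t)) - g (circle t (th t)))). lra. }
  destruct (continuity_ab_min (fun t => g (circle (clamp t) (th (clamp t)))) 0 r)
    as (t0 & Ht0 & Ht0r); [lra| |].
  { intros t _; apply continuity_pt_filterlim.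
    apply continuous_of_lipschitz with L; intros t'.
    assert (Hc := Hclamp1 t t').
    assert (L * Rabs (clamp t' - clamp t) <= L * Rabs (t' - t))
      by (apply Rmult_le_compat_l; auto).
    assert (H1 := Hone _ _ (Hclamp t) (Hclamp t')).
    assert (H2 := Hone _ _ (Hclamp t') (Hclamp t)).
    rewrite (Rabs_minus_sym (clamp t)) in H2. apply Rabs_le; lra. }
  exists (circle (clamp t0) (th (clamp t0))); split; [apply Hin, Hclamp|].
  intros z Hz; unfold closed_disc in Hz.
  assert (Hz0 := Cmod_ge_0 z).
  eapply Rle_trans; [apply (Ht0 (Cmod z)); lra|]. cbv beta.
  replace (clamp (Cmod z)) with (Cmod z)
    by (unfold clamp; rewrite Rmin_left, Rmax_right; lra).
  apply Hmin; auto; lra.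
Qed.

(** At [z + e eta], |h|^2 changes by 2 e Re (conj (h z) dh(z) eta) + O(e^2). Only a short segment
    issuing from [z] has to lie in [D], so [z] may be a boundary point. *)
Lemma hol_descent (D : C -> Prop) (h dh : C -> C) (z eta : C) (e0 : R) :
  hol D h dh -> D z -> 0 < e0 ->
  (forall e, 0 < e < e0 -> D (z + RtoC e * eta)%C) ->
  fst (Cconj (h z) * (dh z * eta))%C < 0 ->
  exists z', D z' /\ Cmod (h z') < Cmod (h z).
Proof.
  intros Hh Hz He0 Hfeas Hneg.
  destruct (hol_bounds _ _ _ Hh) as (M & M0 & _ & _ & Mr & _).
  set (l := (dh z * eta)%C) in *.
  set (N := M * Cmod eta ^ 2).
  assert (HN : 0 <= N) by (apply Rmult_le_pos; [auto | apply pow2_ge_0]).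
  set (p := - fst (Cconj (h z) * l)%C).
  assert (Hp : 0 < p) by (unfold p; lra).
  (* Bound for the coefficient of e^2: the cross term of [h z] with the remainder, then the square
     of the increment. The 1 keeps [B] positive. *)
  set (B := 2 * Cmod (h z) * N + (Cmod l + N) ^ 2 + 1).
  assert (H0 := Cmod_ge_0 (h z)); assert (H1 := Cmod_ge_0 l).
  assert (HB : 0 < B) by (unfold B; nra).
  set (e := Rmin (Rmin 1 (e0 / 2)) (p / B)).
  assert (HpB : 0 < p / B) by (apply Rdiv_lt_0_compat; auto).
  assert (He : 0 < e <= 1 /\ e < e0 /\ e * B <= p).
  { assert (A1 := Rmin_l (Rmin 1 (e0 / 2)) (p / B)).
    assert (A2 := Rmin_r (Rmin 1 (e0 / 2)) (p / B)).
    assert (A3 := Rmin_l 1 (e0 / 2)). assert (A4 := Rmin_r 1 (e0 / 2)).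
    fold e in A1, A2. split; [split|split]; try lra.
    - unfold e; repeat apply Rmin_glb_lt; lra.
    - apply Rle_div_r in A2; auto. }
  destruct He as ([He1 He2] & He3 & He4).
  exists (z + RtoC e * eta)%C; split; [apply Hfeas; lra|].
  specialize (Mr z (z + RtoC e * eta)%C Hz (Hfeas e ltac:(lra))).
  replace (z + RtoC e * eta - z)%C with (RtoC e * eta)%C in Mr by ring.
  set (Rm := (h (z + RtoC e * eta) - h z - dh z * (RtoC e * eta))%C) in *.
  replace (h (z + RtoC e * eta)%C) with (h z + (RtoC e * l + Rm))%C
    by (unfold Rm, l; ring).
  rewrite Cmod_mul_real, Rpow_mult_distr in Mr by lra.
  assert (HR : Cmod Rm <= N * e ^ 2) by (unfold N; lra).
  apply Rsqr_incrst_0; [| apply Cmod_ge_0 | apply Cmod_ge_0].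
  rewrite !Rsqr_pow2.
  replace (Cmod (h z + (RtoC e * l + Rm)) ^ 2)
    with (Cmod (h z) ^ 2 - 2 * e * p + 2 * fst (Cconj (h z) * Rm)%C
          + Cmod (RtoC e * l + Rm) ^ 2)
    by (rewrite !Cmod_sq; unfold p; simpl; ring).
  assert (E1 : fst (Cconj (h z) * Rm)%C <= Cmod (h z) * (N * e ^ 2)).
  { eapply Rle_trans; [apply Rle_abs|]. eapply Rle_trans; [apply fst_le_Cmod|].
    rewrite Cmod_mult, Cmod_conj. apply Rmult_le_compat_l; auto. }
  assert (E2 : Cmod (RtoC e * l + Rm) ^ 2 <= (e * (Cmod l + N)) ^ 2).
  { apply pow_incr; split; [apply Cmod_ge_0|].
    eapply Rle_trans; [apply Cmod_triangle|]. rewrite Cmod_mul_real by lra.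
    assert (N * e ^ 2 <= N * e) by (apply Rmult_le_compat_l; nra). lra. }
  assert (E3 : e * (e * B) <= e * p) by (apply Rmult_le_compat_l; lra).
  unfold B in E3. nra.
Qed.

(** * The extremal derivative and its Pick discs *)

Definition extremal_deriv (s x : R) (z : C) : C :=
  (RtoC (3 * s / 2 * (1 - x ^ 2)) * (z + x) / (1 + x * z) ^ 3)%C.

Definition extremal_deriv2 (s x : R) (z : C) : C :=
  (RtoC (3 * s / 2 * (1 - x ^ 2)) * (1 - 3 * x ^ 2 - 2 * x * z)
   / (1 + x * z) ^ 4)%C.

Lemma Cmod_one_add_ge (x r : R) (z : C) :
  0 <= x -> closed_disc r z -> 1 - x * r <= Cmod (1 + x * z).
Proof.
  intros Hx Hz; unfold closed_disc in Hz.
  assert (H := Cmod_one_sub_ge (- (x * z))%C).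
  replace (1 - - (x * z))%C with (1 + x * z)%C in H by ring.
  rewrite Cmod_opp, Cmod_mul_real in H by lra.
  assert (x * Cmod z <= x * r) by (apply Rmult_le_compat_l; auto). lra.
Qed.

Lemma hol_extremal_deriv (s x r : R) :
  0 <= x -> x * r < 1 ->
  hol (closed_disc r) (extremal_deriv s x) (extremal_deriv2 s x).
Proof.
  intros Hx Hxr.
  assert (Hn : forall z, closed_disc r z -> (1 + x * z)%C <> 0%C).
  { intros z Hz; apply Cmod_pos_neq.
    assert (H := Cmod_one_add_ge x r z Hx Hz); lra. }
  assert (Hi : hol (closed_disc r) (fun z => / (1 + x * z))%C
                 (fun z => - (0 + (0 * z + x * 1))
                           * (/ (1 + x * z) * / (1 + x * z)))%C).
  { apply hol_inv with (1 - x * r); [lra | |].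
    - intros z Hz; apply Cmod_one_add_ge; auto.
    - apply hol_plus; [apply hol_const | apply hol_scal, hol_disc_id]. }
  assert (Hl := hol_plus _ _ _ _ _ (hol_disc_id r) (hol_const (closed_disc r) x)).
  assert (H := hol_scal _ (RtoC (3 * s / 2 * (1 - x ^ 2))) _ _
                 (hol_mult _ _ _ _ _ Hl
                   (hol_mult _ _ _ _ _ Hi (hol_mult _ _ _ _ _ Hi Hi)))).
  revert H; apply hol_ext_deriv; intros z Hz; specialize (Hn z Hz);
    unfold extremal_deriv, extremal_deriv2; set (K := RtoC (3 * s / 2 * (1 - x ^ 2)));
    field; auto.
Qed.

(** The numerator vanishes only at (1 - 3 x^2) / (2 x), so it suffices that 2 x r < 1 - 3 x^2.
    Multiplied by s - x, this follows from the range of [r] and 2 x <= (1 + s x)(s - x). *)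
Lemma extremal_deriv2_neq (s x r : R) (z : C) :
  s ^ 2 = 3 -> 0 < s -> 0 < x -> s * x < 1 ->
  r * (s - x) < 1 - s * x -> closed_disc r z ->
  extremal_deriv2 s x z <> 0%C.
Proof.
  intros Hs Hs0 Hx Hsx Hr Hz.
  assert (Hr0 : 0 <= r) by (eapply Rle_trans; [apply Cmod_ge_0 | apply Hz]).
  destruct (radius_pos s x r) as [H1 H2]; auto.
  assert (Hs1 : 1 < s) by nra. assert (Hx1 : x < 1) by nra.
  assert (Hq : 0 < 1 - x ^ 2) by nra.
  assert (Hn : (1 + x * z)%C <> 0%C).
  { apply Cmod_pos_neq; assert (H := Cmod_one_add_ge x r z ltac:(lra) Hz); nra. }
  unfold extremal_deriv2, Cdiv; repeat apply Cmult_neq_0.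
  - apply Cmod_pos_neq; rewrite Cmod_R, Rabs_right by nra; nra.
  - apply Cmod_pos_neq.
    assert (HA : 2 * (x * r) < 1 - 3 * x ^ 2).
    { apply Rmult_lt_reg_r with (s - x); [nra|].
      assert (E1 : 2 * x * (r * (s - x)) < 2 * x * (1 - s * x))
        by (apply Rmult_lt_compat_l; lra).
      assert (E2 : (1 - s * x) * (2 * x) <= (1 - s * x) * ((1 + s * x) * (s - x)))
        by (apply Rmult_le_compat_l; nra).
      replace (1 - 3 * x ^ 2) with (1 - s ^ 2 * x ^ 2) by (rewrite Hs; ring).
      lra. }
    assert (H := Cmod_triangle (1 - 3 * x ^ 2 - 2 * x * z) (RtoC (2 * x) * z)).
    replace (1 - 3 * x ^ 2 - 2 * x * z + RtoC (2 * x) * z)%C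
      with (RtoC (1 - 3 * x ^ 2)) in H
      by (rewrite RtoC_minus, !RtoC_mult, RtoC_pow; ring).
    rewrite Cmod_R, Rabs_right, Cmod_mul_real in H by nra.
    unfold closed_disc in Hz. nra.
  - apply Cmod_pos_neq; rewrite Cmod_inv, Cmod_pow by (apply Cpow_nz; auto).
    apply Rinv_0_lt_compat, pow_lt, Cmod_gt_0; auto.
Qed.

(** The normalised value [f] lies in the pseudohyperbolic disc about s x that has [w] on its
    boundary, cross-multiplied to avoid quotients. The value [extremal_deriv s x z] corresponds to f
    = w. *)
Definition pick_disc (s x : R) (z v : C) : Prop :=
  let w := (s * (z + x) / (1 + x * z))%C in
  let f := (RtoC (2 / (3 * (1 - x ^ 2))) * (1 + x * z) ^ 2 * v)%C in
  Cmod (f - RtoC (s * x)) * Cmod (1 - RtoC (s * x) * w)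
  <= Cmod (w - RtoC (s * x)) * Cmod (1 - RtoC (s * x) * f).

(* [extremal_deriv s x z] lies on the boundary circle of its Pick disc, and
   [z * extremal_deriv2 s x z] is an outer normal there. *)
Lemma pick_disc_outer_normal (s x r t : R) (z : C) :
  s ^ 2 = 3 -> 0 < s -> 0 < x -> s * x < 1 ->
  0 < r -> r * (s - x) < 1 - s * x -> Cmod z = r -> 0 < t ->
  ~ pick_disc s x z (extremal_deriv s x z + t * (z * extremal_deriv2 s x z))%C.
Proof.
  intros Hs Hs0 Hx Hsx Hr Hrs Hz Ht; unfold pick_disc.
  rewrite <- Hz in Hrs.
  destruct (Cmod_mobius_lt_one s x z) as [Hden Hw]; auto.
  assert (Hn : (1 + x * z)%C <> 0%C)
    by (intros E; apply Hden; rewrite E; apply Cmod_0).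
  assert (Hs1 : 1 < s) by nra. assert (Hx1 : x < 1) by nra.
  assert (Hq : 0 < 1 - x ^ 2) by nra.
  assert (HqC : (1 - x ^ 2)%C <> 0%C).
  { rewrite <- RtoC_pow, <- RtoC_minus; apply Cmod_pos_neq.
    rewrite Cmod_R, Rabs_right; lra. }
  set (w := (s * (z + x) / (1 + x * z))%C) in *.
  set (xi := s * x) in *.
  assert (Hxi : 0 < xi < 1) by (split; [apply Rmult_lt_0_compat; lra | exact Hsx]).
  set (tau := t / (1 - x ^ 2)).
  assert (Htau : 0 < tau) by (apply Rdiv_lt_0_compat; auto).
  assert (Etau : (RtoC tau * (1 - x ^ 2) = t)%C).
  { rewrite <- RtoC_pow, <- RtoC_minus, <- RtoC_mult; f_equal.
    unfold tau; field; lra. }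
  assert (HsC : (s * s = 3)%C)
    by (rewrite <- RtoC_mult; f_equal; lra).
  assert (Ek : (RtoC (2 / (3 * (1 - x ^ 2))) * RtoC (3 * s / 2 * (1 - x ^ 2)) = s)%C)
    by (rewrite <- RtoC_mult; f_equal; field; lra).
  set (f := (RtoC (2 / (3 * (1 - x ^ 2))) * (1 + x * z) ^ 2 *
             (extremal_deriv s x z + t * (z * extremal_deriv2 s x z)))%C).
  (* The normal direction z G' splits into the two Blaschke terms: [w - xi] is s z (1 - x^2) / (1 +
     x z), and [1 - xi * w] is (1 - 3 x^2 - 2 x z) / (1 + x z). *)
  assert (Ef : f = (w + tau * ((w - xi) * (1 - xi * w)))%C).
  { unfold f, extremal_deriv, extremal_deriv2.
    transitivity (RtoC (2 / (3 * (1 - x ^ 2))) * RtoC (3 * s / 2 * (1 - x ^ 2))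
       * ((z + x) / (1 + x * z)
          + t * (z * (1 - 3 * x ^ 2 - 2 * x * z)) / (1 + x * z) ^ 2))%C;
      [field; auto|].
    rewrite Ek, <- Etau.
    transitivity (w + tau * (s * z * (1 - x ^ 2) / (1 + x * z)
                   * ((1 - 3 * x ^ 2 - 2 * x * z) / (1 + x * z))))%C;
      [unfold w; field; auto|].
    f_equal; f_equal; f_equal; unfold w, xi; rewrite RtoC_mult.
    - field; auto.
    - transitivity ((1 + x * z - (s * s) * x * (z + x)) / (1 + x * z))%C;
        [rewrite HsC|]; field; auto. }
  assert (Hwx : 0 < Cmod (w - xi)).
  { apply Cmod_gt_0.
    replace (w - xi)%C with (s * z * (1 - x ^ 2) / (1 + x * z))%C
      by (unfold w, xi; rewrite RtoC_mult; field; auto).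
    unfold Cdiv; repeat apply Cmult_neq_0; auto.
    - apply Cmod_pos_neq; rewrite Cmod_R, Rabs_right; lra.
    - apply Cmod_pos_neq; lra.
    - apply Cmod_pos_neq; rewrite Cmod_inv by auto.
      apply Rinv_0_lt_compat, Cmod_gt_0; auto. }
  fold f. rewrite Ef; clearbody f w xi tau; clear Ef f Etau Ek.
  assert (E1 : (w + tau * ((w - xi) * (1 - xi * w)) - xi
                = (w - xi) * (1 + tau * (1 - xi * w)))%C) by ring.
  assert (E2 : (1 - xi * (w + tau * ((w - xi) * (1 - xi * w)))
                = (1 - xi * w) * (1 + tau * (1 - xi * w)
                    - RtoC (tau * (1 - xi ^ 2))))%C).
  { rewrite RtoC_mult, RtoC_minus, RtoC_pow; ring. }
  rewrite E1, E2, !Cmod_mult. clear E1 E2.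
  assert (Hxw : 0 < Cmod (1 - xi * w)).
  { assert (H := Cmod_one_sub_ge (xi * w)%C).
    rewrite Cmod_mul_real in H by lra. nra. }
  assert (HRe : fst w < 1).
  { eapply Rle_lt_trans; [apply Rle_abs|].
    eapply Rle_lt_trans; [apply fst_le_Cmod | auto]. }
  (* Cancelling |w - xi| |1 - xi w| leaves |X| <= |X - k|, that is 2 Re X <= k. But Re X >= 1 + tau
     (1 - xi), while k = tau (1 - xi)(1 + xi) <= 2 tau (1 - xi). *)
  set (X := (1 + tau * (1 - xi * w))%C).
  set (k := tau * (1 - xi ^ 2)).
  intros H.
  assert (HX : Cmod X <= Cmod (X - RtoC k)).
  { apply Rmult_le_reg_l with (Cmod (w - xi) * Cmod (1 - xi * w));
      [apply Rmult_lt_0_compat; auto | lra]. }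
  assert (HX2 : Cmod X ^ 2 <= Cmod (X - RtoC k) ^ 2)
    by (apply pow_incr; split; auto using Cmod_ge_0).
  assert (EX : Cmod (X - RtoC k) ^ 2 = Cmod X ^ 2 - k * (2 * fst X - k))
    by (rewrite !Cmod_sq; simpl; ring).
  assert (Hk : 0 < k) by (apply Rmult_lt_0_compat; nra).
  assert (EfX : fst X = 1 + tau * (1 - xi * fst w))
    by (unfold X; simpl; ring).
  assert (Hkx : k <= tau * (2 * (1 - xi)))
    by (apply Rmult_le_compat_l; nra).
  assert (tau * (1 - xi) <= tau * (1 - xi * fst w))
    by (apply Rmult_le_compat_l; nra).
  nra.
Qed.

Lemma extremal_value_of_pick_discs (s x r : R) (v : C) :
  s ^ 2 = 3 -> 0 < s -> 0 < x -> s * x < 1 ->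
  0 < r -> r * (s - x) < 1 - s * x ->
  (forall z, Cmod z = r -> pick_disc s x z v) ->
  exists z, closed_disc r z /\ extremal_deriv s x z = v.
Proof.
  intros Hs Hs0 Hx Hsx Hr Hrs Hv.
  destruct (radius_pos s x r) as [Hr1 _]; auto; [lra|].
  assert (Hx1 : x < 1) by nra.
  set (h := fun z => (extremal_deriv s x z + - v)%C).
  assert (Hh : hol (closed_disc r) h (fun z => extremal_deriv2 s x z + 0)%C)
    by (apply hol_plus; [apply hol_extremal_deriv; nra | apply hol_const]).
  destruct (hol_bounds _ _ _ Hh) as (M & M0 & _ & _ & _ & Ml & _).
  destruct (disc_minimum (fun z => Cmod (h z)) r M) as (z0 & Hz0 & Hmin); [lra|auto| |].
  { intros z z' Hz Hz'. eapply Rle_trans; [|apply (Ml z z' Hz Hz')].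
    apply Rabs_le; split.
    - assert (H := Cmod_triangle (h z') (- (h z' - h z))%C).
      replace (h z' + - (h z' - h z))%C with (h z) in H by ring.
      rewrite Cmod_opp in H; lra.
    - assert (H := Cmod_triangle (h z) (h z' - h z)%C).
      replace (h z + (h z' - h z))%C with (h z') in H by ring. lra. }
  exists z0; split; auto.
  destruct (Ceq_dec (h z0) 0%C) as [E|Hne].
  { replace (extremal_deriv s x z0) with (h z0 + v)%C by (unfold h; ring).
    rewrite E; ring. }
  exfalso.
  assert (HG := extremal_deriv2_neq s x r z0 Hs Hs0 Hx Hsx Hrs Hz0).
  assert (Hno : forall eta e0, 0 < e0 ->
     (forall e, 0 < e < e0 -> closed_disc r (z0 + RtoC e * eta)%C) ->
     0 <= fst (Cconj (h z0) * (extremal_deriv2 s x z0 * eta))%C).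
  { intros eta e0 He0 Hfeas.
    apply Rnot_lt_le; intros Hneg.
    destruct (hol_descent _ _ _ z0 eta e0 Hh Hz0 He0 Hfeas) as (z' & Hz' & Hlt).
    - rewrite Cplus_0_r; exact Hneg.
    - specialize (Hmin z' Hz'); simpl in Hmin; lra. }
  assert (Hh2 : 0 < Cmod (h z0) ^ 2) by (apply pow_lt, Cmod_gt_0; auto).
  unfold closed_disc in *.
  destruct (Rle_lt_or_eq_dec _ _ Hz0) as [Hlt|Heq].
  (* An interior minimum is excluded by the Newton direction for h = 0. *)
  - set (eta := (- h z0 / extremal_deriv2 s x z0)%C).
    assert (H := Hno eta ((r - Cmod z0) / (Cmod eta + 1))).
    assert (He := Cmod_ge_0 eta).
    replace (extremal_deriv2 s x z0 * eta)%C with (- h z0)%C in H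
      by (unfold eta; field; auto).
    replace (fst (Cconj (h z0) * - h z0)%C) with (- Cmod (h z0) ^ 2) in H
      by (generalize (h z0); intros a; rewrite Cmod_sq; simpl; ring).
    enough (0 <= - Cmod (h z0) ^ 2) by lra.
    apply H; [apply Rdiv_lt_0_compat; lra|].
    intros e [He1 He2]. apply Rlt_div_r in He2; [|lra].
    eapply Rle_trans; [apply Cmod_triangle|]. rewrite Cmod_mul_real by lra. lra.
  - set (l := (z0 * extremal_deriv2 s x z0)%C).
    assert (Hz0n : z0 <> 0%C) by (apply Cmod_pos_neq; lra).
    assert (Hl : l <> 0%C) by (apply Cmult_neq_0; auto).
    set (kap := (- h z0 / l)%C).
    assert (Ek : (h z0 = - (kap * l))%C) by (unfold kap; field; auto).
    assert (Ek2 : (kap * l = - h z0)%C) by (unfold kap; field; auto).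
    clearbody kap.
    assert (Hl2 : 0 < Cmod l ^ 2) by (apply pow_lt, Cmod_gt_0; auto).
    (* For Re mu < 0 the direction [z0 * mu] points into the disc: |1 + e mu| <= 1 up to e = -2 Re
       mu / |mu|^2. Minimality thus puts [kap] in the polar cone of the left half-plane, which is
       the nonnegative real axis. *)
    assert (Hmu : forall mu, fst mu < 0 -> fst (Cconj kap * mu)%C <= 0).
    { intros mu Hmu.
      assert (Hm2 : 0 < Cmod mu ^ 2) by (rewrite Cmod_sq; nra).
      assert (H := Hno (z0 * mu)%C (- 2 * fst mu / Cmod mu ^ 2)).
      rewrite Ek in H.
      replace (fst (Cconj (- (kap * l)) * (extremal_deriv2 s x z0 * (z0 * mu)))%C)
        with (- (Cmod l ^ 2 * fst (Cconj kap * mu)%C)) in H.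
      2:{ replace (extremal_deriv2 s x z0 * (z0 * mu))%C with (l * mu)%C
            by (unfold l; ring).
          generalize kap l mu; intros a b m; rewrite Cmod_sq; simpl; ring. }
      enough (0 <= - (Cmod l ^ 2 * fst (Cconj kap * mu)%C)) by nra.
      apply H; [apply Rdiv_lt_0_compat; lra|].
      intros e [He1 He2]. apply Rlt_div_r in He2; auto.
      replace (z0 + RtoC e * (z0 * mu))%C with (z0 * (1 + RtoC e * mu))%C by ring.
      rewrite Cmod_mult, Heq. rewrite <- (Rmult_1_r r) at 2.
      apply Rmult_le_compat_l; [lra|].
      apply Cmod_le_of_sq; [lra|]. rewrite Cmod_sq in He2. simpl fst; simpl snd.
      nra. }
    assert (Hk : 0 < fst kap /\ snd kap = 0).
    { destruct (Req_dec (snd kap) 0) as [E0|E0].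
      - split; auto. apply Rnot_le_lt; intros Hle.
        destruct (Rle_lt_or_eq_dec _ _ Hle) as [Hlt|E1].
        + specialize (Hmu kap Hlt); simpl in Hmu; nra.
        + apply Hne. rewrite Ek. replace kap with (RtoC 0); [ring|].
          unfold RtoC; rewrite <- E0 at 2; rewrite <- E1. symmetry; apply surjective_pairing.
      (* This mu makes Re (conj kap mu) equal to 1. *)
      - exfalso. specialize (Hmu (-1, (fst kap + 1) / snd kap)); simpl in Hmu.
        replace (fst kap * -1 - - snd kap * ((fst kap + 1) / snd kap)) with 1 in Hmu
          by (field; auto).
        lra. }
    destruct Hk as [Hk1 Hk2].
    apply (pick_disc_outer_normal s x r (fst kap) z0); auto.
    assert (Ekap : RtoC (fst kap) = kap)
      by (unfold RtoC; rewrite <- Hk2; symmetry; apply surjective_pairing).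
    rewrite Ekap. clear Ekap.
    replace (extremal_deriv s x z0 + kap * (z0 * extremal_deriv2 s x z0))%C with v.
    { apply Hv; auto. }
    fold l. replace (kap * l)%C with (- h z0)%C.
    unfold h; ring.
Qed.

(** * Harmonic majorant of the extremal function *)

(** G up to a constant factor: with y = 1 / (1 + x z) and q = 1 - x^2 one has z + x = (1 - q y) / (x
    y), so (z + x) / (1 + x z)^3 = (y^2 - q y^3) / x. *)
Definition cubic (q : R) (y : C) : C := (y * y - q * (y * y * y))%C.

Definition cubic_slope (q : R) (y y' : C) : C :=
  (y + y' - q * (y * y + y * y' + y' * y'))%C.

Lemma cubic_sub (q : R) (y y' : C) :
  (cubic q y' - cubic q y = (y' - y) * cubic_slope q y y')%C.
Proof. unfold cubic, cubic_slope; ring. Qed.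

(** Image of |z| <= r under z -> 1 / (1 + x z). For x r < 1 it is again a disc, |1 - y| <= x r
    |y|. *)
Definition inverse_disc (x r : R) (y : C) : Prop :=
  exists z, closed_disc r z /\ (1 + x * z <> 0)%C /\ (y * (1 + x * z) = 1)%C.

Lemma extremal_deriv_cubic (s x : R) (y z : C) :
  x <> 0 -> (1 + x * z <> 0)%C -> (y * (1 + x * z) = 1)%C ->
  (extremal_deriv s x z
   = RtoC (3 * s / 2 * (1 - x ^ 2) / x) * cubic (1 - x ^ 2) y)%C.
Proof.
  intros Hx Hn Hy.
  assert (HxC : RtoC x <> 0%C) by (intros E; apply Hx, RtoC_inj, E).
  replace y with (/ (1 + x * z))%C
    by (replace y with (y * (1 + x * z) * / (1 + x * z))%C by (field; auto);
        rewrite Hy; ring).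
  unfold extremal_deriv, cubic, Rdiv.
  rewrite (RtoC_mult _ (/ x)), RtoC_inv, RtoC_minus, RtoC_pow by auto.
  set (K := RtoC (3 * s * / 2 * (1 - x ^ 2))).
  field; auto.
Qed.

(** With y = 1/(1 + a) and y' = 1/(1 + b) the slope is -E y^2 y'^2, where E is 1 - 3 x^2 minus a
    polynomial in a, b with nonnegative coefficients. For |a|, |b| <= x r, |E| is thus at least its
    value at a = b = x r. That value is positive by the third hypothesis, which is 2 x r < 1 - 3
    x^2, the condition that keeps the zero of G' beyond [r]. The bound gives univalence and the
    constant [c] of [hol_section]. *)
Lemma cubic_slope_lower_bound (x r : R) (y y' : C) :
  0 < x -> 0 < r -> 2 * (1 + x * r) < 3 * (1 - x ^ 2) ->
  inverse_disc x r y -> inverse_disc x r y' ->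
  (3 * (1 - x ^ 2) - 2 * (1 + x * r)) * / (1 + x * r) ^ 2
  <= Cmod (cubic_slope (1 - x ^ 2) y y').
Proof.
  intros Hx Hr Hm (z & Hz & Hn & Hy) (z' & Hz' & Hn' & Hy').
  set (e := x * r) in *.
  assert (He : 0 < e) by (apply Rmult_lt_0_compat; auto).
  set (a := (x * z)%C) in *; set (b := (x * z')%C) in *.
  assert (Ha : Cmod a <= e).
  { unfold a; rewrite Cmod_mul_real by lra. apply Rmult_le_compat_l; auto; lra. }
  assert (Hb : Cmod b <= e).
  { unfold b; rewrite Cmod_mul_real by lra. apply Rmult_le_compat_l; auto; lra. }
  set (p := x ^ 2) in *.
  assert (Hp : 0 < p) by (unfold p; apply pow_lt; auto).
  assert (Hp1 : p < 1) by lra.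
  set (Sm := (a + b)%C); set (Pm := (a * b)%C).
  set (E := (RtoC (1 - 3 * p) - (RtoC (3 * p) * Sm + RtoC p * (Sm * Sm)
             + RtoC (3 - p) * Pm + Pm * Sm))%C).
  assert (Eslope : (cubic_slope (1 - p) y y' = - (E * ((y * y) * (y' * y'))))%C).
  { unfold cubic_slope, E, Sm, Pm.
    replace y with (/ (1 + a))%C
      by (replace y with (y * (1 + a) * / (1 + a))%C by (field; auto);
          rewrite Hy; ring).
    replace y' with (/ (1 + b))%C
      by (replace y' with (y' * (1 + b) * / (1 + b))%C by (field; auto);
          rewrite Hy'; ring).
    rewrite !RtoC_minus, !RtoC_mult. field; auto. }
  assert (HS : Cmod Sm <= 2 * e)
    by (eapply Rle_trans; [apply Cmod_triangle|]; lra).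
  assert (HP : Cmod Pm <= e * e)
    by (unfold Pm; rewrite Cmod_mult; apply Rmult_le_compat; auto using Cmod_ge_0).
  assert (HE : (1 + e) ^ 2 * (3 * (1 - p) - 2 * (1 + e)) <= Cmod E).
  { assert (Hrest : Cmod (RtoC (3 * p) * Sm + RtoC p * (Sm * Sm)
             + RtoC (3 - p) * Pm + Pm * Sm)
             <= 3 * p * (2 * e) + p * ((2 * e) * (2 * e)) + (3 - p) * (e * e)
                + (e * e) * (2 * e)).
    { repeat (eapply Rle_trans; [apply Cmod_triangle|]; apply Rplus_le_compat).
      - rewrite Cmod_mul_real by lra. apply Rmult_le_compat_l; auto; lra.
      - rewrite Cmod_mul_real, Cmod_mult by lra.
        apply Rmult_le_compat_l; [lra|]. apply Rmult_le_compat; auto using Cmod_ge_0.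
      - rewrite Cmod_mul_real by lra. apply Rmult_le_compat_l; auto; lra.
      - rewrite Cmod_mult. apply Rmult_le_compat; auto using Cmod_ge_0. }
    assert (H := Cmod_triangle E (RtoC (3 * p) * Sm + RtoC p * (Sm * Sm)
             + RtoC (3 - p) * Pm + Pm * Sm)).
    replace (E + (RtoC (3 * p) * Sm + RtoC p * (Sm * Sm)
             + RtoC (3 - p) * Pm + Pm * Sm))%C with (RtoC (1 - 3 * p)) in H
      by (unfold E; ring).
    rewrite Cmod_R in H. assert (H1 := Rle_abs (1 - 3 * p)).
    assert ((1 + e) ^ 2 * (3 * (1 - p) - 2 * (1 + e))
            = 1 - 3 * p - (3 * p * (2 * e) + p * ((2 * e) * (2 * e))
               + (3 - p) * (e * e) + (e * e) * (2 * e))) by ring.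
    lra. }
  assert (Hlow : forall u w : C, Cmod u <= e -> (w * (1 + u) = 1)%C ->
            / (1 + e) <= Cmod w).
  { intros u w Hu Hw.
    assert (H : Cmod w * Cmod (1 + u) = 1) by (rewrite <- Cmod_mult, Hw; apply Cmod_1).
    assert (H1 : Cmod (1 + u) <= 1 + e)
      by (eapply Rle_trans; [apply Cmod_triangle|]; rewrite Cmod_1; lra).
    apply Rmult_le_reg_r with (1 + e); [lra|]. rewrite Rinv_l by lra.
    assert (H2 := Cmod_ge_0 w). nra. }
  rewrite Eslope, Cmod_opp, !Cmod_mult.
  assert (Hy1 := Hlow a y Ha Hy); assert (Hy1' := Hlow b y' Hb Hy').
  set (m := 3 * (1 - p) - 2 * (1 + e)) in *.
  assert (Hi : 0 < / (1 + e)) by (apply Rinv_0_lt_compat; lra).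
  assert (H4 : (/ (1 + e) * / (1 + e)) * (/ (1 + e) * / (1 + e))
               <= Cmod y * Cmod y * (Cmod y' * Cmod y')).
  { apply Rmult_le_compat; try (apply Rmult_le_compat; lra);
      apply Rmult_le_pos; lra. }
  replace (m * / (1 + e) ^ 2)
    with ((1 + e) ^ 2 * m * ((/ (1 + e) * / (1 + e)) * (/ (1 + e) * / (1 + e))))
    by (field; lra).
  apply Rmult_le_compat; auto.
  - apply Rmult_le_pos; [apply pow2_ge_0 | unfold m; lra].
  - repeat apply Rmult_le_pos; lra.
Qed.

Lemma inverse_disc_bound (x r : R) (y : C) :
  0 < x -> x * r < 1 -> inverse_disc x r y -> Cmod y <= / (1 - x * r).
Proof.
  intros Hx Hxr (z & Hz & Hn & Hy).
  assert (H := Cmod_one_add_ge x r z ltac:(lra) Hz).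
  assert (E : Cmod y * Cmod (1 + x * z) = 1) by (rewrite <- Cmod_mult, Hy; apply Cmod_1).
  apply Rmult_le_reg_r with (1 - x * r); [lra|]. rewrite Rinv_l by lra.
  assert (H2 := Cmod_ge_0 y). nra.
Qed.

Lemma hol_cubic_section (x r : R) (D : C -> Prop) (inv : C -> C) :
  0 < x -> 0 < r -> x * r < 1 -> 2 * (1 + x * r) < 3 * (1 - x ^ 2) ->
  (forall v, D v -> inverse_disc x r (inv v) /\ cubic (1 - x ^ 2) (inv v) = v) ->
  exists d, hol D inv d.
Proof.
  intros Hx Hr Hxr Hm Hinv.
  assert (Hxr0 : 0 < x * r) by (apply Rmult_lt_0_compat; auto).
  set (q := 1 - x ^ 2) in *.
  assert (Hq : 0 < q) by lra.
  set (B := / (1 - x * r)).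
  assert (HB : 0 < B) by (apply Rinv_0_lt_compat; lra).
  assert (HYB : forall y, inverse_disc x r y -> Cmod y <= B)
    by (intros; apply inverse_disc_bound; auto).
  eexists; apply (hol_section D (inverse_disc x r) (cubic q) inv (cubic_slope q) B
           ((3 * q - 2 * (1 + x * r)) * / (1 + x * r) ^ 2) (1 + q * (3 * B))); auto.
  - apply Rmult_lt_0_compat; [lra|]. apply Rinv_0_lt_compat, pow_lt; lra.
  - nra.
  - intros; apply cubic_sub.
  - intros; apply cubic_slope_lower_bound; auto.
  - intros y y' Hy Hy'.
    replace (cubic_slope q y y' - cubic_slope q y y)%C
      with ((1 - q * (y' + (y + y))) * (y' - y))%C by (unfold cubic_slope; ring).
    rewrite Cmod_mult; apply Rmult_le_compat_r; [apply Cmod_ge_0|].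
    eapply Rle_trans; [apply Cmod_one_sub_le|].
    rewrite Cmod_mul_real by lra. apply Rplus_le_compat_l, Rmult_le_compat_l; [lra|].
    assert (H1 := HYB y Hy); assert (H2 := HYB y' Hy').
    assert (H3 := Cmod_triangle y' (y + y)); assert (H4 := Cmod_triangle y y). lra.
Qed.

Section Majorant.

Context (q l : R).

(** Write u = Re y. On the circle |y|^2 = (2u - 1)/l, so |y|^4 |1 - q y|^2 becomes (2u - 1)^2 (A0 +
    B0 u) / l^2. The coefficients [c3] down to [c0] match the powers of u, using Re y^2 = 2u^2 - (2u
    - 1)/l and Re y^3 = 4u^3 - 3u (2u - 1)/l. *)
Let A0 := 1 - q ^ 2 / l.
Let B0 := 2 * q ^ 2 / l - 2 * q.
Let c3 := B0 / l ^ 2.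
Let c2 := 2 * (A0 - B0) / l ^ 2 + 3 * c3 / l.
Let c1 := (B0 - 4 * A0) / l ^ 2 + 2 * c2 / l - 3 * c3 / l.
Let c0 := A0 / l ^ 2 - c2 / l.

Definition harmonic_majorant (y : C) : C :=
  (c0 + c1 * y + c2 * (y * y) + c3 * (y * y * y))%C.

(* [harmonic_majorant] is the polynomial whose real part equals [|cubic|^2] on the circle
   [|y - 1|^2 = (1 - l) |y|^2], which has centre [1 / l]; the sum of squares is
   the mean of [|cubic_slope q w y|^2] over [w] in this circle. *)
Lemma harmonic_majorant_identity (y : C) : l <> 0 ->
  fst (harmonic_majorant y) - Cmod (cubic q y) ^ 2
  = (2 * fst y - 1 - l * Cmod y ^ 2) / l *
    (Cmod (cubic_slope q (RtoC (/ l)) y) ^ 2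
     + (1 - l) / l ^ 2 * Cmod (1 - q * (RtoC (2 / l) + y)) ^ 2
     + q ^ 2 * (1 - l) ^ 2 / l ^ 4).
Proof.
  intros Hl; rewrite !Cmod_sq.
  unfold harmonic_majorant, cubic, cubic_slope, c0, c1, c2, c3, A0, B0.
  destruct y as [u v]; simpl. field; auto.
Qed.

Lemma hol_harmonic_majorant (D : C -> Prop) (f df : C -> C) :
  hol D f df -> exists d, hol D (fun z => harmonic_majorant (f z)) d.
Proof.
  intros Hf; assert (H2 := hol_mult _ _ _ _ _ Hf Hf).
  assert (H3 := hol_mult _ _ _ _ _ H2 Hf).
  eexists; unfold harmonic_majorant.
  repeat apply hol_plus; [apply hol_const | apply hol_scal; eassumption ..].
Qed.

End Majorant.

Lemma cubic_sq_le_harmonic_majorant (x r : R) (y : C) :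
  0 < x -> 0 < r -> x * r < 1 -> inverse_disc x r y ->
  Cmod (cubic (1 - x ^ 2) y) ^ 2
  <= fst (harmonic_majorant (1 - x ^ 2) (1 - r ^ 2 * x ^ 2) y).
Proof.
  intros Hx Hr Hxr (z & Hz & Hn & Hy).
  set (l := 1 - r ^ 2 * x ^ 2).
  assert (Hxr0 : 0 < x * r) by (apply Rmult_lt_0_compat; auto).
  assert (El : 1 - l = (x * r) ^ 2) by (unfold l; ring).
  assert (Hl : 0 < l) by nra.
  assert (H := harmonic_majorant_identity (1 - x ^ 2) l y ltac:(lra)).
  (* Since 1 - y = x z y, this is |1 - y|^2 <= (x r)^2 |y|^2 with (x r)^2 = 1 - l. *)
  assert (Hy2 : 0 <= 2 * fst y - 1 - l * Cmod y ^ 2).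
  { assert (E : (1 - y = x * z * y)%C).
    { replace (1 - y)%C with (y * (1 + x * z) - y)%C by (rewrite Hy; ring). ring. }
    assert (E2 : Cmod (1 - y) ^ 2 = 1 - 2 * fst y + Cmod y ^ 2)
      by (rewrite !Cmod_sq; simpl; ring).
    assert (E3 : Cmod (1 - y) ^ 2 <= (x * r * Cmod y) ^ 2).
    { apply pow_incr; split; [apply Cmod_ge_0|].
      rewrite E, !Cmod_mult, Cmod_R, Rabs_right by lra.
      apply Rmult_le_compat_r; [apply Cmod_ge_0|].
      apply Rmult_le_compat_l; auto; lra. }
    rewrite Rpow_mult_distr, <- El in E3. lra. }
  enough (0 <= fst (harmonic_majorant (1 - x ^ 2) l y) - Cmod (cubic (1 - x ^ 2) y) ^ 2) by lra.
  rewrite H; apply Rmult_le_pos.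
  - apply Rmult_le_pos; auto. apply Rlt_le, Rinv_0_lt_compat; auto.
  - assert (Hi : 0 <= (1 - l) / l ^ 2).
    { rewrite El; apply Rmult_le_pos; [apply pow2_ge_0|].
      apply Rlt_le, Rinv_0_lt_compat, pow_lt; auto. }
    repeat apply Rplus_le_le_0_compat.
    + apply pow2_ge_0.
    + apply Rmult_le_pos; [auto | apply pow2_ge_0].
    + apply Rmult_le_pos; [apply Rmult_le_pos; apply pow2_ge_0|].
      apply Rlt_le, Rinv_0_lt_compat, pow_lt; auto.
Qed.

(** The mean of |G|^2 over |z| = r; multiplied by r^2 it is the first upper bound. *)
Definition mean_square (x r : R) : R :=
  27 * (1 - x ^ 2) ^ 2 *
  ((r ^ 2 + x ^ 2) * (1 - r ^ 2 * x ^ 2) ^ 2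
   - 6 * r ^ 2 * x ^ 2 * (1 - x ^ 2) * (1 - r ^ 2))
  / (4 * (1 - r ^ 2 * x ^ 2) ^ 5).

(** The centre z = 0 corresponds to y = 1, where the mean value property evaluates the majorant. *)
Lemma harmonic_majorant_at_one (s x r : R) :
  s ^ 2 = 3 -> x <> 0 -> 1 - r ^ 2 * x ^ 2 <> 0 ->
  (3 * s / 2 * (1 - x ^ 2) / x) ^ 2
  * fst (harmonic_majorant (1 - x ^ 2) (1 - r ^ 2 * x ^ 2) 1%C) = mean_square x r.
Proof.
  intros Hs Hx Hl.
  replace ((3 * s / 2 * (1 - x ^ 2) / x) ^ 2)
    with (27 / 4 * (1 - x ^ 2) ^ 2 / x ^ 2)
    by (transitivity (9 * s ^ 2 / 4 * (1 - x ^ 2) ^ 2 / x ^ 2);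
        [rewrite Hs|]; field; auto).
  unfold harmonic_majorant, mean_square; simpl. field; split; auto;
    intros E; apply Hl; rewrite <- E; ring.
Qed.

(** * Integral means *)

Definition circle_energy (c : nat -> C) (r : R) : R :=
  RInt (fun t => Cmod (ps c (circle r t)) ^ 2) 0 (2 * PI).

Lemma circle_energy_correct (c : nat -> C) (r : R) :
  radius_one c -> 0 < r < 1 ->
  is_RInt (fun t => Cmod (ps c (circle r t)) ^ 2) 0 (2 * PI) (circle_energy c r).
Proof.
  intros Hc Hr; apply (RInt_correct (V := R_CompleteNormedModule)).
  apply (ex_RInt_continuous (V := R_CompleteNormedModule)); intros t _.
  assert (H := hol_ps c r Hc Hr).
  destruct (hol_circle_continuous r _ _ t ltac:(lra) H) as [H1 _].
  destruct (hol_circle_continuous r _ _ t ltac:(lra) (hol_scal _ (- Ci)%C _ _ H))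
    as [H2 _].
  apply continuous_ext with (fun t =>
    plus (mult (fst (ps c (circle r t))) (fst (ps c (circle r t))))
         (mult (fst (- Ci * ps c (circle r t))%C) (fst (- Ci * ps c (circle r t))%C))).
  - intros u; rewrite Cmod_sq; unfold plus, mult; simpl; ring.
  - apply (continuous_plus (K := R_AbsRing) (V := R_NormedModule));
      apply (continuous_mult (K := R_AbsRing)); auto.
Qed.

(** Split the series as c_0 + z p. The cross term 2 Re (conj c_0 z p) has mean 0, being the real
    part of a holomorphic function that vanishes at 0. Peeling off coefficients in this way yields
    Bessel's inequality without exchanging sum and integral. *)
Lemma circle_energy_step (c : nat -> C) (r : R) :
  radius_one c -> 0 < r < 1 ->
  circle_energy c r
  = 2 * PI * Cmod (c O) ^ 2 + r ^ 2 * circle_energy (fun k => c (S k)) r.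
Proof.
  intros Hc Hr; assert (Hc' := radius_one_shift c Hc).
  set (c' := fun k => c (S k)) in *.
  assert (H := hol_scal _ (Cconj (c O)) _ _
                 (hol_mult _ _ _ _ _ (hol_disc_id r) (hol_ps c' r Hc' Hr))).
  assert (Hm := mean_value_property r _ _ ltac:(lra) H). cbv beta in Hm.
  replace (2 * PI * fst (Cconj (c O) * (0 * ps c' 0))%C) with 0 in Hm
    by (replace (Cconj (c O) * (0 * ps c' 0))%C with (RtoC 0) by ring; simpl; ring).
  assert (Hi := circle_energy_correct c' r Hc' Hr).
  apply is_RInt_unique.
  apply is_RInt_ext with (fun t => plus (plus (Cmod (c O) ^ 2)
     (scal (r ^ 2) (Cmod (ps c' (circle r t)) ^ 2)))
     (scal 2 (fst (Cconj (c O) * (circle r t * ps c' (circle r t)))%C))).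
  - intros t _.
    assert (Hz : Cmod (circle r t) = r) by (apply Cmod_circle; lra).
    rewrite (ps_unfold c) by (auto; lra). fold c'.
    rewrite <- Hz at 1. generalize (circle r t) (ps c' (circle r t)) (c O).
    intros z p a; unfold plus, scal; simpl; unfold mult; simpl.
    change (sqrt (fst z * (fst z * 1) + snd z * (snd z * 1))) with (Cmod z).
    replace (Cmod z * (Cmod z * 1)) with (Cmod z ^ 2) by ring.
    rewrite <- !Rmult_assoc, !Rmult_1_r.
    replace (Cmod a * Cmod a) with (Cmod a ^ 2) by ring.
    replace (Cmod (a + z * p) * Cmod (a + z * p)) with (Cmod (a + z * p) ^ 2) by ring.
    replace (Cmod z ^ 2 * Cmod p * Cmod p) with (Cmod z ^ 2 * Cmod p ^ 2) by ring.
    rewrite !Cmod_sq; simpl; ring.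
  - replace (2 * PI * Cmod (c O) ^ 2 + r ^ 2 * circle_energy c' r)
      with (plus (plus (scal (2 * PI - 0) (Cmod (c O) ^ 2))
                       (scal (r ^ 2) (circle_energy c' r))) (scal 2 0))
      by (unfold plus, scal; simpl; unfold mult; simpl; ring).
    apply (is_RInt_plus (V := R_NormedModule));
      [apply (is_RInt_plus (V := R_NormedModule))|].
    + apply (is_RInt_const (V := R_NormedModule)).
    + apply (is_RInt_scal (V := R_NormedModule)); exact Hi.
    + apply (is_RInt_scal (V := R_NormedModule)); exact Hm.
Qed.

Lemma bessel_inequality (c : nat -> C) (r : R) (n : nat) :
  radius_one c -> 0 < r < 1 ->
  2 * PI * sum_f_R0 (fun k => Cmod (c k) ^ 2 * r ^ (2 * k)) n <= circle_energy c r.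
Proof.
  intros Hc Hr; revert c Hc.
  assert (Hpos : forall c, radius_one c -> 0 <= circle_energy c r).
  { intros c Hc; assert (H := circle_energy_correct c r Hc Hr).
    assert (HP := PI_RGT_0).
    apply (is_RInt_le (fun _ => 0) (fun t => Cmod (ps c (circle r t)) ^ 2) 0 (2 * PI));
      [lra | | exact H | intros; apply pow2_ge_0].
    assert (H0 := is_RInt_const (V := R_NormedModule) 0 (2 * PI) 0).
    exact (eq_ind _ (fun v => is_RInt (fun _ => 0) 0 (2 * PI) v) H0 _
             (Rmult_0_r (2 * PI - 0))). }
  assert (Hr2 : 0 <= r ^ 2) by apply pow2_ge_0.
  induction n as [|n IH]; intros c Hc; rewrite circle_energy_step by auto;
    assert (Hc' := radius_one_shift c Hc).
  - specialize (Hpos _ Hc'). simpl sum_f_R0. simpl (r ^ (2 * 0)).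
    assert (0 <= r ^ 2 * circle_energy (fun k => c (S k)) r)
      by (apply Rmult_le_pos; auto). lra.
  - rewrite decomp_sum by lia. simpl (r ^ (2 * 0)). simpl pred.
    rewrite (sum_eq _ (fun k => Cmod (c (S k)) ^ 2 * r ^ (2 * k) * r ^ 2)).
    + rewrite <- scal_sum. specialize (IH _ Hc'); cbv beta in IH.
      apply Rmult_le_compat_l with (r := r ^ 2) in IH; auto. lra.
    + intros i _; replace (2 * S i)%nat with (2 * i + 2)%nat by lia.
      rewrite pow_add; ring.
Qed.

Lemma ps_zero (c : nat -> C) : radius_one c -> ps c 0%C = c O.
Proof.
  intros Hc; rewrite ps_unfold by (auto; rewrite Cmod_0; lra). ring.
Qed.

(** * Comparison with the extremal function on circles *)

Lemma bloch_rotation (c : nat -> C) (u : C) :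
  bloch c -> Cmod u = 1 ->
  bloch (fun k => c k * u ^ k)%C /\
  forall z, Cmod z < 1 -> ps (fun k => c k * u ^ k)%C z = ps c (u * z)%C.
Proof.
  intros [Hc Hb] Hu.
  assert (Hmod : forall z, Cmod (u * z) = Cmod z)
    by (intros; rewrite Cmod_mult, Hu; ring).
  assert (Hcu : radius_one (fun k => c k * u ^ k)%C).
  { intros r Hr; destruct (Hc r Hr) as (M & HM); exists M; intros k.
    rewrite Cmod_mult, Cmod_pow, Hu, pow1, Rmult_1_r; apply HM. }
  assert (Hps : forall z, Cmod z < 1 ->
            ps (fun k => c k * u ^ k)%C z = ps c (u * z)%C).
  { intros z Hz; apply ps_unique; auto.
    eapply Cseq_cv_ext; [|apply ps_cv; [auto | rewrite Hmod; auto]].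
    intros n; apply Csum_ext; intros k; rewrite Cpow_mult_l; ring. }
  split; [split; auto|auto].
  intros z Hz; rewrite Hps, <- (Hmod z) by auto; apply Hb; rewrite Hmod; auto.
Qed.

Lemma bloch_value_extremal (c : nat -> C) (s x r : R) (z : C) :
  s ^ 2 = 3 -> 0 < s -> 0 < x -> s * x < 1 ->
  bloch c -> c O = RtoC (3 * s / 2 * x * (1 - x ^ 2)) ->
  r * (s - x) < 1 - s * x -> closed_disc r z ->
  exists w, closed_disc r w /\ extremal_deriv s x w = ps c z.
Proof.
  intros Hs Hs0 Hx Hsx Hb Hc0 Hr Hz; unfold closed_disc in Hz.
  assert (Hz0 := Cmod_ge_0 z).
  assert (Hs1 : 1 < s) by nra. assert (Hx1 : x < 1) by nra.
  assert (Hrz : Cmod z * (s - x) < 1 - s * x).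
  { eapply Rle_lt_trans; [|apply Hr]. apply Rmult_le_compat_r; lra. }
  destruct (radius_pos s x (Cmod z)) as [Hz1 _]; auto.
  destruct (Rle_lt_or_eq_dec _ _ Hz0) as [Hpos|He].
  - destruct (extremal_value_of_pick_discs s x (Cmod z) (ps c z))
      as (w & Hw & Ew); auto.
    + intros z' Hz'.
      assert (Hzn : z' <> 0%C) by (apply Cmod_pos_neq; lra).
      destruct (bloch_rotation c (z / z')%C Hb) as [Hbu Hpsu].
      { rewrite Cmod_div, Hz' by auto. field; lra. }
      assert (H := bloch_schwarz_pick _ s x z' Hs Hs0 Hx Hsx Hbu).
      rewrite Hpsu in H by lra.
      replace (z / z' * z')%C with z in H by (field; auto).
      apply H; [rewrite Hc0; simpl; ring | rewrite Hz'; auto].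
    + exists w; split; auto. unfold closed_disc in *; lra.
  (* At the centre there is no circle of points to rotate, but F' and G agree there by the
     normalisation of [c O]. *)
  - exists 0%C; split; [unfold closed_disc; rewrite Cmod_0; lra|].
    assert (E : z = 0%C) by (apply Cmod_eq_0; auto).
    rewrite E, ps_zero, Hc0 by apply Hb.
    unfold extremal_deriv.
    replace (3 * s / 2 * x * (1 - x ^ 2)) with (3 * s / 2 * (1 - x ^ 2) * x) by ring.
    rewrite (RtoC_mult _ x). replace (1 + x * 0)%C with (RtoC 1) by ring. field.
Qed.

Lemma bloch_mean_square_le (c : nat -> C) (s x r : R) (n : nat) :
  s ^ 2 = 3 -> 0 < s -> 0 < x -> s * x < 1 ->
  bloch c -> c O = RtoC (3 * s / 2 * x * (1 - x ^ 2)) ->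
  0 < r -> r * (s - x) < 1 - s * x ->
  sum_f_R0 (fun k => Cmod (c k) ^ 2 * r ^ (2 * k)) n <= mean_square x r.
Proof.
  intros Hs Hs0 Hx Hsx Hb Hc0 Hr0 Hr.
  assert (Hs1 : 1 < s) by nra. assert (Hx1 : x < 1) by nra.
  destruct (radius_pos s x r) as [Hr1 _]; auto; [lra|].
  assert (Hxr : x * r < 1) by nra. assert (Hxr0 : 0 < x * r) by nra.
  set (q := 1 - x ^ 2) in *.
  assert (Hq : 0 < q) by (unfold q; nra).
  (* The range of [r] gives 2 (1 + x r)(s - x) < 2 s q, and s x < 1 gives 3 x <= s, hence 2 s q <= 3
     q (s - x). *)
  assert (Hm : 2 * (1 + x * r) < 3 * q).
  { apply Rmult_lt_reg_r with (s - x); [lra|].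
    assert (E1 : 2 * x * (r * (s - x)) < 2 * x * (1 - s * x))
      by (apply Rmult_lt_compat_l; lra).
    assert (E2 : 3 * x <= s) by nra.
    assert (E3 : q * (3 * x) <= q * s) by (apply Rmult_le_compat_l; lra).
    unfold q in *; lra. }
  set (K := 3 * s / 2 * q / x).
  assert (HK : 0 < K).
  { unfold K; apply Rdiv_lt_0_compat; auto. apply Rmult_lt_0_compat; lra. }
  assert (HKC : RtoC K <> 0%C) by (apply Cmod_pos_neq; rewrite Cmod_R, Rabs_right; lra).
  set (good := fun (v y : C) => inverse_disc x r y /\ cubic q y = v).
  set (inv := fun v => epsilon (inhabits (RtoC 0)) (good v)).
  set (f := fun z => (RtoC (/ K) * ps c z)%C).
  assert (HfK : forall z, ps c z = (K * f z)%C)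
    by (intros z; unfold f; rewrite RtoC_inv by lra; field; auto).
  assert (Hex : forall z, closed_disc r z -> exists y, good (f z) y).
  { intros z Hz.
    destruct (bloch_value_extremal c s x r z) as (w & Hw & Ew); auto.
    assert (Hn : (1 + x * w)%C <> 0%C).
    { apply Cmod_pos_neq. assert (H := Cmod_one_add_ge x r w ltac:(lra) Hw). lra. }
    exists (/ (1 + x * w))%C; split.
    - exists w; repeat split; auto. field; auto.
    - rewrite (extremal_deriv_cubic s x (/ (1 + x * w))%C w) in Ew;
        [| lra | auto | field; auto].
      unfold f; rewrite <- Ew. fold q. fold K.
      rewrite RtoC_inv by lra. field; auto. }
  assert (Hinv : forall v, (exists y, good v y) -> good v (inv v))
    by (intros v Hv; apply epsilon_spec; auto).
  (* The domain is the bare set of values of [cubic] on [inverse_disc]; [hol] does not ask it to be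
     open, so no open mapping theorem is involved. *)
  destruct (hol_cubic_section x r (fun v => exists y, good v y) inv) as (dinv & Hdinv);
    auto.
  assert (Hf := hol_scal _ (RtoC (/ K)) _ _ (hol_ps c r (proj1 Hb) (conj Hr0 Hr1))).
  fold f in Hf.
  assert (Hy := hol_comp _ _ _ _ _ _ Hex Hdinv Hf).
  destruct (hol_harmonic_majorant q (1 - r ^ 2 * x ^ 2) _ _ _ Hy) as (dU & HU).
  assert (Hmv := mean_value_property r _ _ Hr0 HU). cbv beta in Hmv.
  (* The mean value is attained at [inv (f 0)]. The point 1 is a preimage of [f 0], and the lower
     bound on the slope excludes a second one. *)
  assert (Ey0 : inv (f 0%C) = 1%C).
  { assert (Hd0 : closed_disc r 0%C) by (unfold closed_disc; rewrite Cmod_0; lra).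
    destruct (Hinv _ (Hex _ Hd0)) as [Hy0 Ec0].
    assert (Hy1 : inverse_disc x r 1%C).
    { exists 0%C; repeat split; auto; [|ring].
      replace (1 + x * 0)%C with (RtoC 1) by ring. apply C1_nz. }
    assert (Hlow := cubic_slope_lower_bound x r 1%C (inv (f 0%C)) Hx Hr0 Hm Hy1 Hy0).
    fold q in Hlow.
    assert (Hc1 : cubic q 1%C = f 0%C).
    { unfold f; rewrite ps_zero, Hc0, <- RtoC_mult by apply Hb.
      unfold cubic; rewrite <- !RtoC_mult, <- RtoC_minus; f_equal.
      unfold K, q; field. repeat split; unfold q in *; lra. }
    assert (E := cubic_sub q 1%C (inv (f 0%C))).
    rewrite Ec0, Hc1 in E.
    assert (Hpos : 0 < (3 * q - 2 * (1 + x * r)) * / (1 + x * r) ^ 2).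
    { apply Rmult_lt_0_compat; [lra|]. apply Rinv_0_lt_compat, pow_lt; lra. }
    assert (Hsl : cubic_slope q 1%C (inv (f 0%C)) <> 0%C)
      by (apply Cmod_pos_neq; lra).
    replace (inv (f 0%C)) with ((inv (f 0%C) - 1) * cubic_slope q 1 (inv (f 0))
                               / cubic_slope q 1 (inv (f 0)) + 1)%C
      by (field; auto).
    rewrite <- E; field; auto. }
  rewrite Ey0 in Hmv.
  assert (Hbes := bessel_inequality c r n (proj1 Hb) (conj Hr0 Hr1)).
  assert (HP := PI_RGT_0).
  assert (Hle : circle_energy c r
     <= scal (K ^ 2) (2 * PI * fst (harmonic_majorant q (1 - r ^ 2 * x ^ 2) 1%C))).
  { eapply is_RInt_le;
      [ | apply (circle_energy_correct c r (proj1 Hb) (conj Hr0 Hr1))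
        | apply (is_RInt_scal (V := R_NormedModule)); exact Hmv | ]; [lra|].
    intros t _. assert (Hin : closed_disc r (circle r t))
      by (apply circle_in_disc; lra).
    destruct (Hinv _ (Hex _ Hin)) as [Hy1 Ec1].
    rewrite HfK, Cmod_mul_real, Rpow_mult_distr by lra.
    apply Rmult_le_compat_l; [apply pow2_ge_0|].
    rewrite <- Ec1 at 1. apply cubic_sq_le_harmonic_majorant; auto. }
  assert (Hone := harmonic_majorant_at_one s x r Hs ltac:(lra)).
  fold q in Hone; fold K in Hone.
  assert (Hl : 1 - r ^ 2 * x ^ 2 <> 0)
    by (assert ((x * r) ^ 2 < 1) by nra; lra).
  rewrite <- Hone by auto.
  apply Rmult_le_reg_l with (2 * PI); [lra|].
  change (circle_energy c r <= K ^ 2 * (2 * PI *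
            fst (harmonic_majorant q (1 - r ^ 2 * x ^ 2) 1%C))) in Hle.
  lra.
Qed.

(** * Integration in the radius *)

Definition area_bound (x r : R) : R :=
  27 * r ^ 2 * (1 - x ^ 2) ^ 2 *
  (3 * x ^ 2 * (1 - r ^ 2) ^ 2 + (1 - x ^ 2 * r ^ 2) * (r ^ 2 - x ^ 2))
  / (8 * (1 - r ^ 2 * x ^ 2) ^ 4).

(** Identifies the second upper bound, which vanishes at r = 0, as the primitive of 2 r
    [mean_square]. *)
Lemma is_derive_area_bound (x r : R) :
  1 - r ^ 2 * x ^ 2 <> 0 ->
  is_derive (area_bound x) r (2 * r * mean_square x r).
Proof.
  intros Hl; unfold area_bound, mean_square; auto_derive.
  - simpl in Hl; repeat apply Rmult_integral_contrapositive_currified; auto; lra.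
  - simpl; field. intros E; apply Hl; rewrite <- E; ring.
Qed.

Lemma continuity_mean_square (x r : R) :
  1 - r ^ 2 * x ^ 2 <> 0 -> continuity_pt (mean_square x) r.
Proof.
  intros Hl; apply derivable_continuous_pt, ex_derive_Reals_0.
  unfold mean_square; auto_derive.
  simpl in Hl; repeat apply Rmult_integral_contrapositive_currified; auto; lra.
Qed.

Lemma continuity_even_power_sum (u : nat -> R) (n : nat) (r : R) :
  continuity_pt (fun r => sum_f_R0 (fun k => u k * r ^ (2 * k)) n) r.
Proof.
  induction n as [|n IH].
  - simpl; apply continuity_pt_const; intros a b; reflexivity.
  - simpl sum_f_R0. apply (continuity_pt_plus _ (fun r => u (S n) * r ^ (2 * S n)));
      [exact IH|].
    apply derivable_continuous_pt, ex_derive_Reals_0; auto_derive; auto.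
Qed.

Lemma is_derive_even_power_sum (u : nat -> R) (n : nat) (r : R) :
  is_derive (fun r => sum_f_R0 (fun k => u k / INR (S k) * r ^ (2 * S k)) n) r
    (2 * r * sum_f_R0 (fun k => u k * r ^ (2 * k)) n).
Proof.
  assert (Hterm : forall k, is_derive (fun r => u k / INR (S k) * r ^ (2 * S k)) r
                    (2 * r * (u k * r ^ (2 * k)))).
  { intros k; assert (Hk : INR (S k) <> 0) by (apply not_0_INR; lia).
    apply is_derive_ext with (fun r => u k / INR (S k) * (r ^ 2) ^ S k).
    { intros t; rewrite pow_mult; reflexivity. }
    rewrite pow_mult. auto_derive; auto.
    change (pred (S k)) with k.
    replace (match k with 0%nat => 1 | S _ => INR k + 1 end) with (INR (S k))
      by reflexivity.
    rewrite !Rmult_1_r. replace (r ^ 2) with (r * r) by ring. field; auto. }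
  induction n as [|n IH]; [apply Hterm|].
  rewrite tech5, Rmult_plus_distr_l.
  apply (is_derive_plus (K := R_AbsRing) (V := R_NormedModule)
           (fun r => sum_f_R0 (fun k => u k / INR (S k) * r ^ (2 * S k)) n)
           (fun r => u (S n) / INR (S (S n)) * r ^ (2 * S (S n)))); auto.
Qed.

Lemma nonneg_left_limit (h : R -> R) (b : R) :
  0 < b -> continuity_pt h b -> (forall r, 0 < r < b -> 0 <= h r) -> 0 <= h b.
Proof.
  intros Hb Hc H; apply Rnot_lt_le; intros Hneg.
  destruct (Hc (- h b)) as (d & Hd & Hd2); [lra|].
  set (r := b - Rmin (d / 2) (b / 2)).
  assert (H1 := Rmin_l (d / 2) (b / 2)); assert (H2 := Rmin_r (d / 2) (b / 2)).
  assert (H3 : 0 < Rmin (d / 2) (b / 2)) by (apply Rmin_glb_lt; lra).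
  specialize (H r ltac:(unfold r; lra)).
  assert (H4 : Rabs (h r - h b) < - h b).
  { apply Hd2; split; [split; [exact I | unfold r; lra]|].
    simpl; unfold Rdist, r. rewrite Rabs_left; lra. }
  rewrite Rabs_right in H4; lra.
Qed.

Lemma nonneg_series_bounded (u : nat -> R) (M : R) :
  (forall k, 0 <= u k) -> (forall n, sum_f_R0 u n <= M) ->
  exists l, infinite_sum u l /\ l <= M.
Proof.
  intros Hu HM.
  destruct (growing_cv (sum_f_R0 u)) as (l & Hl).
  - intros n; rewrite tech5; specialize (Hu (S n)); lra.
  - exists M; intros y (n & ->); apply HM.
  - exists l; split; [exact Hl|].
    exact (Rle_cv_lim HM Hl (Un_cv_const M)).
Qed.

(** The weights k and k^2 vanish at k = 0, while the coefficients of F' start from b_1. The shifted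
    sum has one more nonnegative term at the top. *)
Lemma sum_le_shift (u : nat -> R) (n : nat) :
  u O = 0 -> (forall k, 0 <= u k) ->
  sum_f_R0 u n <= sum_f_R0 (fun k => u (S k)) n.
Proof.
  intros H0 Hu; assert (H := decomp_sum u (S n) ltac:(lia)).
  rewrite tech5, H0 in H; simpl pred in H; specialize (Hu (S n)); lra.
Qed.

(** * From the class B to the coefficients of F' *)

Definition deriv_coeff (b : nat -> Cpx) (k : nat) : C :=
  Cscal (INR (S k)) (b (S k)).

Lemma Cnorm_Cmod (z : C) : Cnorm z = Cmod z.
Proof. unfold Cnorm, Cmod; f_equal; simpl; ring. Qed.

Lemma Cscal_RtoC (t : R) (z : C) : Cscal t z = (RtoC t * z)%C :> C.
Proof. unfold Cscal, RtoC, Cmult; simpl; f_equal; ring. Qed.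

Lemma dF_terms_deriv_coeff (b : nat -> Cpx) (z : C) (k : nat) :
  dF_terms b z k = (deriv_coeff b k * z ^ k)%C :> C.
Proof.
  unfold dF_terms, deriv_coeff; rewrite !Cscal_RtoC.
  change (Cmul (b (S k)) (Defs.Cpow z k)) with (Cmult (b (S k)) (Coquelicot.Complex.Cpow z k)).
  ring.
Qed.

(** Convergence of the derivative series at each real r < 1 bounds its partial sums, hence its
    terms; this is already [radius_one]. *)
Lemma in_class_B_bloch (b : nat -> Cpx) :
  in_class_B b -> bloch (deriv_coeff b).
Proof.
  intros HB.
  assert (Hrad : radius_one (deriv_coeff b)).
  { intros r Hr.
    destruct (HB (RtoC r)) as (_ & l & Hl & _).
    { unfold in_disc; rewrite Cnorm_Cmod, Cmod_R, Rabs_right; lra. }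
    assert (Hbd : exists M, forall n, Cmod (Csum (dF_terms b (RtoC r)) n) <= M).
    { destruct Hl as [H1 H2].
      destruct (maj_by_pos _ (exist _ _ H1)) as (M1 & _ & HM1).
      destruct (maj_by_pos _ (exist _ _ H2)) as (M2 & _ & HM2).
      exists (M1 + M2); intros n; eapply Rle_trans; [apply Cmod_le_add|].
      apply Rplus_le_compat; auto. }
    destruct Hbd as (M & HM). exists (M + M); intros k.
    assert (Hk : Cmod (dF_terms b (RtoC r) k) <= M + M).
    { destruct k as [|k]; [specialize (HM O); simpl in HM; assert (H := Cmod_ge_0 (dF_terms b (RtoC r) 0)); lra|].
      replace (dF_terms b (RtoC r) (S k))
        with (Csum (dF_terms b (RtoC r)) (S k) - Csum (dF_terms b (RtoC r)) k)%C
        by (rewrite Csum_S; ring).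
      eapply Rle_trans; [apply Cmod_triangle|].
      rewrite Cmod_opp. apply Rplus_le_compat; auto. }
    rewrite dF_terms_deriv_coeff, Cmod_mult, Cmod_pow, Cmod_R, Rabs_right in Hk by lra.
    exact Hk. }
  split; auto.
  intros z Hz; destruct (HB z) as (_ & l & Hl & Hle).
  { unfold in_disc; rewrite Cnorm_Cmod; auto. }
  rewrite !Cnorm_Cmod in Hle.
  rewrite (ps_unique _ z l Hrad Hz); auto.
  eapply Cseq_cv_ext; [|exact Hl].
  intros n; apply Csum_ext; intros k; apply dF_terms_deriv_coeff.
Qed.

(** Adds the largest admissible radius, at which w = 1 for z = r and the strict estimates break
    down. Both sides are continuous there, so the inequality passes to the limit from the left. *)
Lemma bloch_mean_square_le_closed (c : nat -> C) (s x r : R) (n : nat) :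
  s ^ 2 = 3 -> 0 < s -> 0 < x -> s * x < 1 ->
  bloch c -> c O = RtoC (3 * s / 2 * x * (1 - x ^ 2)) ->
  0 < r -> r * (s - x) <= 1 - s * x ->
  1 - r ^ 2 * x ^ 2 <> 0 /\
  sum_f_R0 (fun k => Cmod (c k) ^ 2 * r ^ (2 * k)) n <= mean_square x r.
Proof.
  intros Hs Hs0 Hx Hsx Hb Hc0 Hr0 Hr.
  assert (Hs1 : 1 < s) by nra. assert (Hx1 : x < 1) by nra.
  assert (Hr1 : r < 1) by nra.
  assert (Hl : 1 - r ^ 2 * x ^ 2 <> 0).
  { assert (0 < x * r < 1) by nra. assert ((x * r) ^ 2 < 1) by nra. lra. }
  split; auto.
  set (h := fun r => mean_square x r
                     - sum_f_R0 (fun k => Cmod (c k) ^ 2 * r ^ (2 * k)) n).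
  enough (0 <= h r) by (unfold h in *; lra).
  apply nonneg_left_limit; auto.
  - apply continuity_pt_minus; [apply continuity_mean_square; auto|].
    apply (continuity_even_power_sum (fun k => Cmod (c k) ^ 2)).
  - intros t Ht; unfold h.
    enough (sum_f_R0 (fun k => Cmod (c k) ^ 2 * t ^ (2 * k)) n <= mean_square x t) by lra.
    apply (bloch_mean_square_le c s x t n); auto; [lra|nra].
Qed.

(** The difference of the two sides vanishes at 0 and its derivative at t is 2 t times the gap in
    [bloch_mean_square_le_closed], hence nonnegative. *)
Lemma bloch_area_le (c : nat -> C) (s x r : R) (n : nat) :
  s ^ 2 = 3 -> 0 < s -> 0 < x -> s * x < 1 ->
  bloch c -> c O = RtoC (3 * s / 2 * x * (1 - x ^ 2)) ->
  0 < r -> r * (s - x) <= 1 - s * x ->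
  sum_f_R0 (fun k => Cmod (c k) ^ 2 / INR (S k) * r ^ (2 * S k)) n <= area_bound x r.
Proof.
  intros Hs Hs0 Hx Hsx Hb Hc0 Hr0 Hr.
  assert (Hs1 : 1 < s) by nra. assert (Hx1 : x < 1) by nra.
  set (h := fun r => area_bound x r
        - sum_f_R0 (fun k => Cmod (c k) ^ 2 / INR (S k) * r ^ (2 * S k)) n).
  set (dh := fun r => 2 * r * mean_square x r
        - 2 * r * sum_f_R0 (fun k => Cmod (c k) ^ 2 * r ^ (2 * k)) n).
  assert (Hin : forall t, 0 < t <= r -> 1 - t ^ 2 * x ^ 2 <> 0 /\
     sum_f_R0 (fun k => Cmod (c k) ^ 2 * t ^ (2 * k)) n <= mean_square x t).
  { intros t Ht; apply (bloch_mean_square_le_closed c s x t n); auto; [lra|].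
    eapply Rle_trans; [|apply Hr]. apply Rmult_le_compat_r; lra. }
  assert (Hder : forall t, 0 <= t <= r -> is_derive h t (dh t)).
  { intros t Ht; apply (is_derive_minus (K := R_AbsRing) (V := R_NormedModule)).
    - apply is_derive_area_bound.
      destruct (Rle_lt_or_eq_dec 0 t) as [H|H]; [lra|apply Hin; lra|].
      rewrite <- H; lra.
    - apply (is_derive_even_power_sum (fun k => Cmod (c k) ^ 2)). }
  destruct (MVT_gen h 0 r dh) as (t & Ht & E).
  - intros t; rewrite Rmin_left, Rmax_right by lra; intros; apply Hder; lra.
  - intros t; rewrite Rmin_left, Rmax_right by lra; intros.
    apply derivable_continuous_pt, ex_derive_Reals_0; exists (dh t); apply Hder; lra.
  - rewrite Rmin_left, Rmax_right in Ht by lra.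
    assert (H0 : h 0 = 0).
    { unfold h, area_bound; rewrite sum_eq_R0; [field|].
      intros k _; rewrite pow_i by lia; ring. }
    assert (Hd : 0 <= dh t).
    { unfold dh; destruct (Rle_lt_or_eq_dec 0 t) as [H|H]; [lra| |subst t; lra].
      destruct (Hin t) as [_ H1]; [lra|]. nra. }
    assert (0 <= h r) by (assert (0 <= dh t * (r - 0)) by (apply Rmult_le_pos; lra); lra).
    unfold h in *; lra.
Qed.

Theorem theorem1 (b : nat -> Cpx) (a x r : R) :
  in_class_B b ->
  b 1%nat = (a, 0) ->
  0 < a < 1 ->
  0 < x < 1 / sqrt 3 ->
  a = 3 * sqrt 3 / 2 * x * (1 - x ^ 2) ->
  0 < r <= (sqrt (1 / 3) - x) / (1 - x * sqrt (1 / 3)) ->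
  (exists l : R,
     infinite_sum (fun k => INR k ^ 2 * Cnorm (b k) ^ 2 * r ^ (2 * k)) l /\
     l <= 27 * r ^ 2 * (1 - x ^ 2) ^ 2 *
            ((r ^ 2 + x ^ 2) * (1 - r ^ 2 * x ^ 2) ^ 2
             - 6 * r ^ 2 * x ^ 2 * (1 - x ^ 2) * (1 - r ^ 2))
          / (4 * (1 - r ^ 2 * x ^ 2) ^ 5)) /\
  (exists l : R,
     infinite_sum (fun k => INR k * Cnorm (b k) ^ 2 * r ^ (2 * k)) l /\
     l <= 27 * r ^ 2 * (1 - x ^ 2) ^ 2 *
            (3 * x ^ 2 * (1 - r ^ 2) ^ 2 + (1 - x ^ 2 * r ^ 2) * (r ^ 2 - x ^ 2))
          / (8 * (1 - r ^ 2 * x ^ 2) ^ 4)).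
Proof.
  intros HB Hb1 _ [Hx Hx3] Ha [Hr0 Hr].
  set (s := sqrt 3) in *.
  assert (Hs0 : 0 < s) by (apply sqrt_lt_R0; lra).
  assert (Hs : s ^ 2 = 3) by (apply pow2_sqrt; lra).
  assert (Hs3 : sqrt (1 / 3) = 1 / s)
    by (rewrite sqrt_div_alt, sqrt_1 by lra; reflexivity).
  assert (Hsx : s * x < 1).
  { apply Rlt_div_r in Hx3; auto. lra. }
  assert (Hr' : r * (s - x) <= 1 - s * x).
  { rewrite Hs3 in Hr.
    assert (Hsx' : 0 < s - x) by nra.
    replace ((1 / s - x) / (1 - x * (1 / s))) with ((1 - s * x) / (s - x)) in Hr
      by (field; lra).
    apply Rle_div_r in Hr; auto. }
  set (c := deriv_coeff b).
  assert (Hbl := in_class_B_bloch b HB). fold c in Hbl.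
  assert (Hc0 : c O = RtoC (3 * s / 2 * x * (1 - x ^ 2))).
  { unfold c, deriv_coeff; rewrite Hb1, <- Ha.
    unfold Cscal, RtoC; simpl; f_equal; ring. }
  (* So k^2 |b_k|^2 and k |b_k|^2 at k = i + 1 are |c_i|^2 and |c_i|^2 / (i + 1). *)
  assert (Hcb : forall k, Cmod (c k) ^ 2 = INR (S k) ^ 2 * Cnorm (b (S k)) ^ 2).
  { intros k; unfold c, deriv_coeff.
    rewrite Cscal_RtoC, Cmod_mul_real, Cnorm_Cmod, Rpow_mult_distr by apply pos_INR.
    reflexivity. }
  assert (Hterm : forall m k j, 0 <= m -> 0 <= m * Cnorm (b k) ^ 2 * r ^ j).
  { intros m k j Hm; apply Rmult_le_pos; [|apply pow_le; lra].
    apply Rmult_le_pos; [auto | apply pow2_ge_0]. }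
  split; apply nonneg_series_bounded.
  - intros k; apply Hterm, pow2_ge_0.
  - intros n.
    destruct (bloch_mean_square_le_closed c s x r n) as [Hl H]; auto.
    apply Rle_trans with (r ^ 2 * mean_square x r).
    2:{ right; unfold mean_square; field.
        intros E; apply Hl; rewrite <- E; ring. }
    apply Rmult_le_compat_l with (r := r ^ 2) in H; [|apply pow2_ge_0].
    eapply Rle_trans; [|apply H]. rewrite scal_sum.
    rewrite (sum_eq (fun i => Cmod (c i) ^ 2 * r ^ (2 * i) * r ^ 2)
      (fun i => INR (S i) ^ 2 * Cnorm (b (S i)) ^ 2 * r ^ (2 * S i))).
    2:{ intros i _; rewrite Hcb.
        replace (2 * S i)%nat with (2 * i + 2)%nat by lia. rewrite pow_add; ring. }
    apply (sum_le_shift (fun k => INR k ^ 2 * Cnorm (b k) ^ 2 * r ^ (2 * k)));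
      [simpl; ring | intros k; apply Hterm, pow2_ge_0].
  - intros k; apply Hterm, pos_INR.
  - intros n.
    assert (H := bloch_area_le c s x r n Hs Hs0 Hx Hsx Hbl Hc0 Hr0 Hr').
    eapply Rle_trans; [|apply H].
    rewrite (sum_eq (fun k => Cmod (c k) ^ 2 / INR (S k) * r ^ (2 * S k))
      (fun i => INR (S i) * Cnorm (b (S i)) ^ 2 * r ^ (2 * S i))).
    2:{ intros i _; rewrite Hcb. field. apply not_0_INR; lia. }
    apply (sum_le_shift (fun k => INR k * Cnorm (b k) ^ 2 * r ^ (2 * k)));
      [simpl; ring | intros k; apply Hterm, pos_INR].
Qed.
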